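(* For $\sigma>0$ let $f_{\sigma^2}$ denote the density of the free unitary normal distribution $\mathfrak N_{\sigma^2}$ with respect to the length measure on the unit circle $\mathbb T$. For all $x\in(-2,2)$ we have $$\lim_{\sigma^2\downarrow0}\sigma f_{\sigma^2}(e^{i\sigma x})=\frac1{2\pi}\sqrt{4-x^2}.$$
   Context: For a probability measure $\mu$ on $\mathbb T=\{|z|=1\}$, the $\psi$-transform is $\psi_\mu(z)=\int_{\mathbb T}\frac{uz}{1-uz}\mu(du)$, $|z|<1$. If $\psi_\mu'(0)=\int_{\mathbb T} u\,\mu(du)\neq0$, then $\psi_\mu$ has an analytic inverse $\psi_\mu^{-1}$ near $0$ and the $S$-transform is $S_\mu(z)=\frac{1+z}{z}\psi_\mu^{-1}(z)$. The free unitary normal distribution $\mathfrak N_{\sigma^2}$, $\sigma^2>0$, is the (unique) probability measure on $\mathbb T$ with $S_{\mathfrak N_{\sigma^2}}(z)=e^{\sigma^2(z+\frac12)}$ for $z$ near $0$. Its (continuous) density is given by $f_{\sigma^2}(e^{i\theta})=\frac{2}{\pi\sigma^2}\operatorname{Im}\zeta_{\sigma^2/4}\left(\frac{\theta-\pi}{2}\right)$, $\theta\in[-\pi,\pi)$, where for $t>0$ and $\operatorname{Im}\theta>0$, $\zeta_t(\theta)$ is the unique solution $\zeta$ of $\zeta-t\tan\zeta=\theta$ in the upper half-plane, and $\zeta_t$ is extended by continuity to the closed upper half-plane. *)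

(* Defs.v *)
From HB Require Import structures.
From mathcomp Require Import all_boot all_order all_algebra.
From mathcomp Require Import all_classical all_reals all_analysis.
From mathcomp Require Import measurable_realfun complex.

Set Implicit Arguments.
Unset Strict Implicit.
Unset Printing Implicit Defensive.

Import Order.TTheory GRing.Theory Num.Theory.
Import numFieldNormedType.Exports.

Local Open Scope classical_set_scope.
Local Open Scope ring_scope.
Local Open Scope complex_scope.

(* [R[i]^o] is convertible to [R[i]]; the alias carries the topology of the
   modulus and the structure of a normed space over the complex field. *)
Notation Cx R := (R[i]^o)%type.

Definition unit_circle (R : realType) : set (Cx R) := [set z | `|z| = 1].

(* A subtype, so that it carries the subspace topology of the complex plane. *)
Definition circle (R : realType) : Type := set_type (@unit_circle R).

HB.instance Definition _ (R : realType) := Topological.on (circle R).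

Definition cval (R : realType) (u : circle R) : R[i] := set_val u.

Definition cis (R : realType) (t : R) : R[i] := cos t +i* sin t.

Lemma normr_cis (R : realType) (t : R) : unit_circle (cis t : Cx R).
Proof. by rewrite /unit_circle /= normc_def /= cos2Dsin2 sqrtr1. Qed.

Definition expi (R : realType) (t : R) : circle R :=
  SigSub (mem_set (normr_cis t)).

HB.instance Definition _ (R : realType) := isPointed.Build (circle R) (expi 0).

Notation borel_circle R := (g_sigma_algebraType (@open (circle R))).

Lemma continuous_cis (R : realType) : continuous (@cis R : R -> Cx R).
Proof.
move=> t; apply/cvgrPdist_lt => /= e; rewrite ltcE /= => /andP[/eqP ime e0].
have e20 : 0 < complex.Re e / 2 by rewrite divr_gt0.
near=> s.
rewrite normc_def ltcE /= ime eqxx /=.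
have ha : `|cos t - cos s| < complex.Re e / 2.
  by near: s; by apply: (cvgr_dist_lt _ _ (@continuous_cos R t)).
have hb : `|sin t - sin s| < complex.Re e / 2.
  by near: s; by apply: (cvgr_dist_lt _ _ (@continuous_sin R t)).
have : (cos t - cos s) ^+ 2 + (sin t - sin s) ^+ 2
    <= (`|cos t - cos s| + `|sin t - sin s|) ^+ 2.
  rewrite [leRHS]sqrrD !real_normK ?num_real// [leRHS]addrAC lerDl.
  by rewrite mulrn_wge0 ?mulr_ge0.
move=> /ler_wsqrtr /le_lt_trans; apply.
by rewrite sqrtr_sqr ger0_norm ?addr_ge0// (splitr (complex.Re e)) ltrD.
Unshelve. all: by end_near. Qed.

Lemma continuous_expi (R : realType) : continuous (@expi R).
Proof. by apply/continuous_comp_initial; exact: continuous_cis. Qed.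

Lemma measurable_expi (R : realType) :
  measurable_fun setT (@expi R : measurableTypeR R -> borel_circle R).
Proof.
apply: (@measurability _ _ _ (borel_circle R) _ _ (@open (circle R))) => //.
move=> _ [U oU <-]; rewrite setTI.
by apply: open_measurable; apply: open_comp => // t _; exact: continuous_expi.
Qed.

Definition arc (R : realType) : set (measurableTypeR R) := `[- pi, pi[%classic.

Lemma measurable_arc (R : realType) : measurable (@arc R).
Proof. exact: measurable_itv. Qed.

Definition circle_length (R : realType) : set (borel_circle R) -> \bar R :=
  pushforward (mrestr (@lebesgue_measure R) (@measurable_arc R))
    (@expi R : measurableTypeR R -> borel_circle R).

Section circle_length_measure.
Variable R : realType.

Let m : {measure set (borel_circle R) -> \bar R} :=
  measure_function_pushforward__canonical__measure_function_Measure
    (mrestr (@lebesgue_measure R) (@measurable_arc R)) (@measurable_expi R).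

HB.instance Definition _ := isMeasure.Build _ _ _ (@circle_length R)
  (@measure0 _ _ _ m) (@measure_ge0 _ _ _ m) (@measure_semi_sigma_additive _ _ _ m).

End circle_length_measure.

Definition cexp (R : realType) (z : R[i]) : R[i] :=
  (expR (complex.Re z))%:C * cis (complex.Im z).

Definition Cintegral (R : realType) d (T : measurableType d)
    (mu : {measure set T -> \bar R}) (f : T -> R[i]) : R[i] :=
  (\int[mu]_x complex.Re (f x)) +i* (\int[mu]_x complex.Im (f x)).

Definition circle_mean (R : realType) (mu : probability (borel_circle R) R) : R[i] :=
  Cintegral mu (fun u : borel_circle R => cval u).

(* Meaningful for [`|z| < 1]; only the germ at [0] is used below. *)
Definition psi_transform (R : realType) (mu : probability (borel_circle R) R)
    (z : R[i]) : R[i] :=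
  Cintegral mu (fun u : borel_circle R => cval u * z / (1 - cval u * z)).

Definition analytic_at (R : realType) (g : R[i] -> R[i]) (a : R[i]) : Prop :=
  \forall z \near (a : Cx R), derivable (g : Cx R -> Cx R) z 1.

Definition analytic_inverse_at0 (R : realType) (p g : R[i] -> R[i]) : Prop :=
  [/\ g 0 = 0, analytic_at g 0,
      \forall z \near (0 : Cx R), p (g z) = z &
      \forall z \near (0 : Cx R), g (p z) = z].

(* The S-transform is a germ at [0], defined only when the mean is nonzero;
   its value at [0] itself is a removable singularity, hence the punctured neighbourhood. *)
Definition is_S_transform (R : realType) (mu : probability (borel_circle R) R)
    (S : R[i] -> R[i]) : Prop :=
  circle_mean mu != 0 /\
  exists2 g : R[i] -> R[i], analytic_inverse_at0 (psi_transform mu) g &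
    \forall z \near (0 : Cx R)^', S z = (1 + z) / z * g z.

Definition free_unitary_normal (R : realType) (s : R)
    (mu : probability (borel_circle R) R) : Prop :=
  is_S_transform mu (fun z => cexp (s%:C * (z + 2^-1))).

(* Continuity singles out the version of the density, so that its values at
   points are determined by the measure. *)
Definition continuous_density (R : realType)
    (mu : probability (borel_circle R) R) (f : circle R -> R) : Prop :=
  [/\ continuous f, forall u, 0 <= f u &
      forall A : set (borel_circle R), measurable A ->
        mu A = (\int[@circle_length R]_(u in A) (f u)%:E)%E].

(* Main.v *)
(* Let [s = sigma^2] and [h z = 1 + 2 psi z], the Herglotz transform of the
   measure. The S-transform says that [psi] inverts [w / (1 + w) e^(s (w + 1/2))]
   near [0], i.e. [z (h + 1) = (h - 1) e^(s h / 2)]; both sides being real-analytic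
   along a ray, this equation persists on the whole disc. There [Re h > 0], and
   comparing moduli gives [|h - 1| <= 2 / sigma], so that [w = sigma h] is bounded.
   Expanding the equation at [z = r e^(-i sigma x)], [r] near [1], to second order
   in [sigma] yields [(w + i x)^2 = 4 - x^2 + O(sigma)], and [Re w > 0] selects the
   root with [Re w = sqrt (4 - x^2) + O(sigma)]. Finally [Re h] is the Poisson
   integral of the density [f], so [Re (h (r e^(-i t)))] tends to [2 pi f (e^(i t))]
   as [r] tends to [1]. *)

Require Import Defs.
From HB Require Import structures.
From mathcomp Require Import all_boot all_order all_algebra.
From mathcomp Require Import all_classical all_reals all_analysis.
From mathcomp Require Import measurable_realfun complex ring lra.

Import Order.TTheory GRing.Theory Num.Theory.
Import numFieldNormedType.Exports.

Local Open Scope classical_set_scope.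
Local Open Scope ring_scope.

Local Open Scope complex_scope.
Import ComplexField.Normc.

Set Implicit Arguments.
Unset Strict Implicit.
Unset Printing Implicit Defensive.

(** The S-transform gives the equation for [psi] only near 0, in a neighbourhood depending on
    [sigma], whereas the density appears only as the radius tends to 1; continuation along a ray
    bridges the gap. A ray is handled as a function of a real variable carrying explicit Taylor
    coefficients with a geometric bound valid on the whole interval. This class is closed under
    sums, products and [cexp], and the uniform bound lets vanishing spread in steps of fixed length.
    The modulus bound on [h] legitimates the expansion: a priori [h] might blow up as [sigma]
    decreases, but with [w] bounded the exponent [sigma^2 h / 2 = sigma w / 2] is of order [sigma].
    The radius [r] is chosen after [sigma]: beyond [1 - sigma^2], so that it perturbs the equation
    only at second order, and so close to 1 that the Poisson integral is within 1 of [2 pi f]. The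
    prefactor [sigma] turns this crude tolerance into an error [sigma], so the speed of the boundary
    convergence may depend on [sigma] in any way. The outcome is the explicit rate
    [(145 / sqrt (4 - x^2) + 1) sigma]. *)

(** * Moduli, real and imaginary parts of complex numbers *)

Section complex_numbers.
Variable R : realType.
Implicit Types (z w : R[i]) (r : R).

Lemma normc_sqrt z : normc z = Num.sqrt (complex.Re z ^+ 2 + complex.Im z ^+ 2).
Proof. by case: z. Qed.

Lemma normc_ge0 z : 0 <= normc z.
Proof. by rewrite normc_sqrt sqrtr_ge0. Qed.

Lemma sqr_normc_ReIm z :
  normc z ^+ 2 = complex.Re z ^+ 2 + complex.Im z ^+ 2.
Proof. by rewrite normc_sqrt sqr_sqrtr// addr_ge0 ?sqr_ge0. Qed.

Lemma normc_real r : normc r%:C = `|r|.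
Proof. by rewrite normc_sqrt /= expr0n addr0 sqrtr_sqr. Qed.

Lemma ler_Re_normc z : `|complex.Re z| <= normc z.
Proof. by rewrite -sqrtr_sqr normc_sqrt ler_wsqrtr// lerDl sqr_ge0. Qed.

Lemma ler_Im_normc z : `|complex.Im z| <= normc z.
Proof. by rewrite -sqrtr_sqr normc_sqrt ler_wsqrtr// lerDr sqr_ge0. Qed.

Lemma ler_normc_ReIm z : normc z <= `|complex.Re z| + `|complex.Im z|.
Proof.
rewrite -(@ler_pXn2r _ 2) ?nnegrE ?normc_ge0 ?addr_ge0//.
rewrite sqr_normc_ReIm sqrrD !real_normK ?num_real//.
by rewrite addrAC lerDl mulrn_wge0 ?mulr_ge0.
Qed.

Lemma ler_normcD z w : normc (z + w) <= normc z + normc w.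
Proof. exact: le_normcD. Qed.

Lemma normcX z n : normc (z ^+ n) = normc z ^+ n.
Proof.
by elim: n => [|n IH]; rewrite ?expr0 ?normc1// !exprS normcM IH.
Qed.

Lemma normc_nat n : normc (n%:R : R[i]) = n%:R.
Proof. by rewrite -(rmorph_nat (real_complex R)) normc_real normr_nat. Qed.

Lemma normc_cis r : normc (cis r) = 1.
Proof. by rewrite normc_sqrt /= cos2Dsin2 sqrtr1. Qed.

Lemma normc_cexp z : normc (cexp z) = expR (complex.Re z).
Proof.
by rewrite normcM normc_cis mulr1 normc_real ger0_norm ?expR_ge0.
Qed.

Lemma ReM z w : complex.Re (z * w) =
  complex.Re z * complex.Re w - complex.Im z * complex.Im w.
Proof. by case: z w => [a b] [c d]. Qed.

Lemma ImM z w : complex.Im (z * w) =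
  complex.Re z * complex.Im w + complex.Im z * complex.Re w.
Proof. by case: z w => [a b] [c d]. Qed.

Lemma ReD z w : complex.Re (z + w) = complex.Re z + complex.Re w.
Proof. by case: z w => [a b] [c d]. Qed.

Lemma ImD z w : complex.Im (z + w) = complex.Im z + complex.Im w.
Proof. by case: z w => [a b] [c d]. Qed.

Lemma ReN z : complex.Re (- z) = - complex.Re z.
Proof. by case: z. Qed.

Lemma ImN z : complex.Im (- z) = - complex.Im z.
Proof. by case: z. Qed.

Lemma Re_nat n : complex.Re (n%:R : R[i]) = n%:R.
Proof. by rewrite -(rmorph_nat (real_complex R)). Qed.

Lemma Im_nat n : complex.Im (n%:R : R[i]) = 0.
Proof. by rewrite -(rmorph_nat (real_complex R)). Qed.

Lemma complex_eqP z w :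
  complex.Re z = complex.Re w -> complex.Im z = complex.Im w -> z = w.
Proof. by case: z w => [a b] [c d] /= -> ->. Qed.

Lemma Re_cexp z : complex.Re (cexp z) = expR (complex.Re z) * cos (complex.Im z).
Proof. by rewrite /cexp /= mul0r subr0. Qed.

Lemma Im_cexp z : complex.Im (cexp z) = expR (complex.Re z) * sin (complex.Im z).
Proof. by rewrite /cexp /= mul0r addr0. Qed.

End complex_numbers.

(** * Derivatives of complex-valued functions of a real variable *)

Section complex_derivative.
Variable R : realType.
Implicit Types (F G : R -> R[i]) (x : R) (l c : R[i]).

Lemma is_derive_ext (f g : R -> R) (x l l' : R) :
  is_derive x 1 f l -> f =1 g -> l = l' -> is_derive x 1 g l'.
Proof. by move=> fl /funext <- <-. Qed.

(** Derivation is read on the two coordinates, so that real calculus, notably monotonicity from the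
    sign of a derivative, applies to each of them. *)
Definition is_cderive F x l :=
  is_derive x 1 (fun t => complex.Re (F t)) (complex.Re l) /\
  is_derive x 1 (fun t => complex.Im (F t)) (complex.Im l).

Lemma is_cderive_ext F G x l l' :
  is_cderive F x l -> F =1 G -> l = l' -> is_cderive G x l'.
Proof. by move=> Fl /funext <- <-. Qed.

Lemma is_cderive_cst c x : is_cderive (fun=> c) x 0.
Proof. by split; exact: is_derive_cst. Qed.

Lemma is_cderive_real x : is_cderive (fun t => t%:C) x 1.
Proof.
split => /=; first exact: is_derive_id.
exact: is_derive_cst.
Qed.

Lemma is_cderiveD F G x l l' : is_cderive F x l -> is_cderive G x l' ->
  is_cderive (fun t => F t + G t) x (l + l').
Proof.
move=> [Fl1 Fl2] [Gl1 Gl2]; split.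
- by apply: (is_derive_ext (is_deriveD Fl1 Gl1)) => [t|]; rewrite ReD.
- by apply: (is_derive_ext (is_deriveD Fl2 Gl2)) => [t|]; rewrite ImD.
Qed.

Lemma is_cderiveM F G x l l' : is_cderive F x l -> is_cderive G x l' ->
  is_cderive (fun t => F t * G t) x (l * G x + F x * l').
Proof.
move=> [Fl1 Fl2] [Gl1 Gl2]; split.
- apply: (is_derive_ext (is_deriveB (is_deriveM Fl1 Gl1) (is_deriveM Fl2 Gl2))).
    by move=> t; rewrite ReM.
  rewrite /GRing.scale /= ReD !ReM; ring.
- apply: (is_derive_ext (is_deriveD (is_deriveM Fl1 Gl2) (is_deriveM Fl2 Gl1))).
    by move=> t; rewrite ImM.
  rewrite /GRing.scale /= ImD !ImM; ring.
Qed.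

Lemma is_cderive_sum n (F : nat -> R -> R[i]) x (l : nat -> R[i]) :
  (forall k, (k < n)%N -> is_cderive (F k) x (l k)) ->
  is_cderive (fun t => \sum_(k < n) F k t) x (\sum_(k < n) l k).
Proof.
elim: n => [_|n IH Fl].
  rewrite big_ord0; apply: (is_cderive_ext (is_cderive_cst 0 x)) => // t.
  by rewrite big_ord0.
rewrite big_ord_recr/=.
apply: (is_cderive_ext (is_cderiveD (IH _) (Fl n _))) => //.
- by move=> k kn; apply: Fl; rewrite ltnS ltnW.
- by move=> t; rewrite big_ord_recr.
Qed.

Lemma is_cderive_cexp F x l :
  is_cderive F x l -> is_cderive (fun t => cexp (F t)) x (l * cexp (F x)).
Proof.
move=> [Fl1 Fl2].
have e := is_derive1_comp (is_derive_expR (complex.Re (F x))) Fl1.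
have c := is_derive1_comp (is_derive_cos (complex.Im (F x))) Fl2.
have s := is_derive1_comp (is_derive_sin (complex.Im (F x))) Fl2.
split.
- apply: (is_derive_ext (is_deriveM e c)) => [t|]; first by rewrite Re_cexp.
  rewrite /GRing.scale /= ReM Re_cexp Im_cexp; ring.
- apply: (is_derive_ext (is_deriveM e s)) => [t|]; first by rewrite Im_cexp.
  rewrite /GRing.scale /= ImM Re_cexp Im_cexp; ring.
Qed.

End complex_derivative.

(** * Real-analytic complex-valued functions *)

Section analytic.
Variable R : realType.
Implicit Types (F G : R -> R[i]) (x y rho C K : R) (d e : nat -> R -> R[i]).

(* [d n] plays the role of [F^(n) / n!] with [F = d 0]; the geometric bound
   says that [F] is real-analytic, uniformly on the interval. *)
Definition analytic_jet rho d :=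
  (forall n x, `|x| < rho -> is_cderive (d n) x (n.+1%:R * d n.+1 x)) /\
  exists C K, [/\ 0 < C, 0 < K &
    forall n x, `|x| < rho -> normc (d n x) <= C * K ^+ n].

Definition analytic_on rho F :=
  exists2 d, analytic_jet rho d & forall x, `|x| < rho -> d 0 x = F x.

Lemma analytic_on_cst rho (c : R[i]) : analytic_on rho (fun=> c).
Proof.
exists (fun n => if n is 0 then fun=> c else fun=> 0) => //; split.
  move=> n x _; apply: (is_cderive_ext (is_cderive_cst (if n is 0 then c else 0) x)).
    by case: n.
  by rewrite mulr0.
exists (normc c + 1), 1; split=> [|//|[|n] x _].
- by rewrite ltr_wpDl ?normc_ge0.
- by rewrite expr0 mulr1 lerDl.
- by rewrite normc0 mulr_ge0 ?addr_ge0 ?normc_ge0 ?exprn_ge0.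
Qed.

Lemma analytic_on_real rho : analytic_on rho (fun t => t%:C).
Proof.
exists (fun n => if n is n'.+1 then fun=> (n' == 0)%:R else fun t => t%:C) => //.
split.
  move=> [|n] x _; first by rewrite mul1r; exact: is_cderive_real.
  by rewrite mulr0; exact: is_cderive_cst.
exists (1 + `|rho|), 1; split=> [|//|[|n] x xrho].
- by rewrite ltr_pwDl.
- rewrite normc_real expr0 mulr1 (le_trans (ltW xrho))//.
  by rewrite (le_trans (ler_norm _))// lerDr.
- rewrite normc_nat expr1n mulr1 ler_wpDr//.
  by rewrite -[leRHS](mulr1n 1) ler_nat; case: (n == 0).
Qed.

Lemma analytic_onD rho F G :
  analytic_on rho F -> analytic_on rho G -> analytic_on rho (fun t => F t + G t).
Proof.
move=> [d [dd [C [K [C0 K0 dCK]]]] dF] [e [de [C' [K' [C'0 K'0 eCK]]]] eG].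
exists (fun n t => d n t + e n t); last by move=> x xrho; rewrite dF// eG.
split=> [n x xrho|].
  by apply: is_cderive_ext (is_cderiveD (dd n x xrho) (de n x xrho)) _ _ => //; ring.
exists (C + C'), (K + K'); split=> [||n x xrho]; do ?exact: addr_gt0.
rewrite (le_trans (ler_normcD _ _))// mulrDl lerD//.
  rewrite (le_trans (dCK _ _ xrho))// ler_pM2l// lerXn2r ?nnegrE ?addr_ge0 ?ltW//.
  by rewrite ltrDl.
rewrite (le_trans (eCK _ _ xrho))// ler_pM2l// lerXn2r ?nnegrE ?addr_ge0 ?ltW//.
by rewrite ltrDr.
Qed.

(** Leibniz rule on Taylor coefficients: in degree [n + 1] the weights [k] and [n + 1 - k] produced
    by the two derivatives add up to [n + 1]. *)
Lemma weighted_convolution n (c e : nat -> R[i]) :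
  \sum_(k < n.+1) (k.+1%:R * c k.+1 * e (n - k)%N +
                   c k * ((n - k).+1%:R * e (n - k).+1)) =
  n.+1%:R * \sum_(k < n.+2) c k * e (n.+1 - k)%N.
Proof.
transitivity (\sum_(k < n.+2) (k%:R * c k * e (n.+1 - k)%N) +
              \sum_(k < n.+2) (c k * ((n.+1 - k)%:R * e (n.+1 - k)%N))).
  rewrite big_split/=; congr (_ + _).
    rewrite [RHS]big_ord_recl/= !mul0r add0r.
    by apply: eq_bigr => k _; rewrite /bump/= add1n subSS.
  rewrite [RHS]big_ord_recr/= subnn mul0r mulr0 addr0.
  by apply: eq_bigr => k _; rewrite subSn// -ltnS.
rewrite -big_split/= mulr_sumr; apply: eq_bigr => k _.
have -> : n.+1%:R = k%:R + (n.+1 - k)%:R :> R[i].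
  by rewrite -natrD subnKC// -ltnS.
ring.
Qed.

Lemma normc_sum n (c : nat -> R[i]) (b : R) :
  (forall k, (k < n)%N -> normc (c k) <= b) ->
  normc (\sum_(k < n) c k) <= n%:R * b.
Proof.
elim: n => [_|n IH cb]; first by rewrite big_ord0 normc0 mul0r.
rewrite big_ord_recr/= (le_trans (ler_normcD _ _))// -natr1 mulrDl mul1r.
by rewrite lerD ?cb// IH// => k kn; rewrite cb// ltnS ltnW.
Qed.

(** The coefficients of the product form the Cauchy product. Each of its [n + 1] terms is at most
    [C C' (K + K')^n], and [n + 1 <= 2^n] is absorbed into the ratio [2 (K + K')]. *)
Lemma analytic_onM rho F G :
  analytic_on rho F -> analytic_on rho G -> analytic_on rho (fun t => F t * G t).
Proof.
move=> [d [dd [C [K [C0 K0 dCK]]]] dF] [e [de [C' [K' [C'0 K'0 eCK]]]] eG].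
exists (fun n t => \sum_(k < n.+1) d k t * e (n - k)%N t); last first.
  by move=> x xrho; rewrite big_ord1 subnn dF// eG.
split=> [n x xrho|].
  rewrite -(weighted_convolution n (d ^~ x) (e ^~ x)).
  apply: (@is_cderive_sum _ n.+1 (fun k t => d k t * e (n - k)%N t) x
    (fun k => k.+1%:R * d k.+1 x * e (n - k)%N x +
      d k x * ((n - k).+1%:R * e (n - k).+1 x))) => k kn.
  by apply: is_cderiveM; [exact: dd|exact: de].
exists (C * C'), (2 * (K + K')); split=> [||n x xrho].
- exact: mulr_gt0.
- by rewrite mulr_gt0// addr_gt0.
have KK : 0 <= K + K' by rewrite ltW// addr_gt0.
rewrite exprMn mulrCA.
apply: (@le_trans _ _ (n.+1%:R * (C * C' * (K + K') ^+ n))).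
  apply: (@normc_sum _ (fun k => d k x * e (n - k)%N x)) => k kn.
  rewrite normcM.
  rewrite (le_trans (ler_pM (normc_ge0 _) (normc_ge0 _) (dCK _ _ xrho) (eCK _ _ xrho)))//.
  rewrite mulrACA ler_pM2l ?mulr_gt0// -[in leRHS](@subnKC k n) ?exprD; last first.
    by rewrite -ltnS.
  rewrite ler_pM ?exprn_ge0 ?(ltW K0) ?(ltW K'0)//.
    by rewrite lerXn2r ?nnegrE ?(ltW K0)// lerDl ltW.
  by rewrite lerXn2r ?nnegrE ?(ltW K'0)// lerDr ltW.
rewrite ler_wpM2r ?mulr_ge0 ?exprn_ge0 ?(ltW C0) ?(ltW C'0)//.
by rewrite -natrX ler_nat ltn_expl.
Qed.

End analytic.

(** * Taylor coefficients of the exponential of an analytic function *)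

Section analytic_exp.
Variable R : realType.
Implicit Types (F G : R -> R[i]) (x y rho C K : R) (d e : nat -> R -> R[i]).

(* [exp_jet_upto d n m] is the [m]-th coefficient for [m <= n]; the recursion
   is [y' = F' y] read on Taylor coefficients. *)
Fixpoint exp_jet_upto d (n m : nat) (x : R) : R[i] :=
  if n is n'.+1 then
    if (m <= n')%N then exp_jet_upto d n' m x
    else n'.+1%:R^-1 *
      \sum_(k < n'.+1) k.+1%:R * d k.+1 x * exp_jet_upto d n' (n' - k)%N x
  else cexp (d 0 x).

Definition exp_jet d n := exp_jet_upto d n n.

Lemma exp_jet_uptoE d n m x : (m <= n)%N -> exp_jet_upto d n m x = exp_jet d m x.
Proof.
elim: n m => [|n IH] m; first by rewrite leqn0 => /eqP ->.
rewrite leq_eqVlt => /predU1P[-> //|]; rewrite ltnS => mn /=.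
by rewrite mn IH.
Qed.

Lemma exp_jet0 d x : exp_jet d 0 x = cexp (d 0%N x).
Proof. by []. Qed.

Lemma exp_jetS d n x : n.+1%:R * exp_jet d n.+1 x =
  \sum_(k < n.+1) k.+1%:R * d k.+1 x * exp_jet d (n - k) x.
Proof.
rewrite {1}/exp_jet /= ltnn mulrA divff ?pnatr_eq0// mul1r.
by apply: eq_bigr => k _; rewrite exp_jet_uptoE// leq_subr.
Qed.

(** Differentiating the recursion for the coefficient of degree [n + 1] gives, by strong induction,
    a weighted convolution of [c k = (k + 1) d (k + 1)] with the exponential coefficients;
    [weighted_convolution] folds it into the recursion one degree higher. *)
Lemma is_cderive_exp_jet d n x :
  (forall m, is_cderive (d m) x (m.+1%:R * d m.+1 x)) ->
  is_cderive (exp_jet d n) x (n.+1%:R * exp_jet d n.+1 x).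
Proof.
move=> dd; elim/ltn_ind: n => -[_|n IH].
  apply: (is_cderive_ext (is_cderive_cexp (dd 0%N))) => //.
  by rewrite exp_jetS big_ord1 /= subnn.
have nz : (n.+1%:R : R[i]) != 0 by rewrite pnatr_eq0.
pose S t := n.+1%:R^-1 *
  \sum_(k < n.+1) k.+1%:R * d k.+1 t * exp_jet d (n - k) t.
have jS t : exp_jet d n.+1 t = S t.
  by rewrite /S -exp_jetS mulrA mulVf// mul1r.
pose c k := k.+1%:R * d k.+1 x.
pose e k := exp_jet d k x.
have dS : is_cderive S x (0 * (\sum_(k < n.+1) c k * e (n - k)%N) +
    n.+1%:R^-1 * \sum_(k < n.+1) ((0 * d k.+1 x + k.+1%:R * (k.+2%:R * d k.+2 x))
       * e (n - k)%N + c k * ((n - k).+1%:R * e (n - k).+1))).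
  apply: is_cderiveM; first exact: is_cderive_cst.
  apply: (@is_cderive_sum _ n.+1
    (fun k t => k.+1%:R * d k.+1 t * exp_jet d (n - k) t) x
    (fun k => (0 * d k.+1 x + k.+1%:R * (k.+2%:R * d k.+2 x))
       * e (n - k)%N + c k * ((n - k).+1%:R * e (n - k).+1))) => k kn.
  apply: is_cderiveM; last by apply: IH; rewrite ltnS leq_subr.
  by apply: is_cderiveM; [exact: is_cderive_cst|exact: dd].
apply: (is_cderive_ext dS) => [t|]; first by rewrite jS.
rewrite mul0r add0r exp_jetS.
apply: (mulfI nz); rewrite mulrA divff// mul1r.
transitivity (\sum_(k < n.+1) (k.+1%:R * c k.+1 * e (n - k)%N +
    c k * ((n - k).+1%:R * e (n - k).+1))).
  by apply: eq_bigr => k _; congr (_ + _); rewrite /c; ring.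
by rewrite weighted_convolution.
Qed.

(** The relation [C K = L - K] makes the sum telescope. It dictates the ratio [L = K (C + 1)] for
    which the bound on the exponential coefficients reproduces itself. *)
Lemma geometric_convolution C K L m : C * K = L - K ->
  \sum_(k < m.+1) C * K ^+ k.+1 * L ^+ (m - k) = L ^+ m.+1 - K ^+ m.+1.
Proof.
move=> CK; elim: m => [|m IHm]; first by rewrite big_ord1 /= subnn mulr1 !expr1.
rewrite big_ord_recr/= subnn expr0 mulr1.
transitivity (L * (L ^+ m.+1 - K ^+ m.+1) + (L - K) * K ^+ m.+1).
  rewrite -IHm mulr_sumr -CK; congr (_ + _); last by rewrite -mulrA -exprS.
  apply: eq_bigr => k _; rewrite subSn; last by rewrite -ltnS.
  by rewrite [L ^+ (m - k).+1]exprS mulrCA.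
by rewrite [L ^+ m.+2]exprS [K ^+ m.+2]exprS; ring.
Qed.

Lemma analytic_on_cexp rho F :
  analytic_on rho F -> analytic_on rho (fun t => cexp (F t)).
Proof.
move=> [d [dd [C [K [C0 K0 dCK]]]] dF].
exists (exp_jet d); last by move=> x xrho; rewrite /exp_jet /= dF.
split=> [n x xrho|].
  by apply: is_cderive_exp_jet => m; exact: dd.
exists (expR C), (K * (C + 1)); split.
- exact: expR_gt0.
- by rewrite mulr_gt0// ltr_wpDl// ltW.
elim/ltn_ind => -[_|n IH] x xrho.
  rewrite expr0 mulr1 exp_jet0 normc_cexp ler_expR.
  rewrite (le_trans (ler_norm _))// (le_trans (ler_Re_normc _))//.
  by rewrite (le_trans (dCK _ _ xrho))// expr0 mulr1.
have n0 : (0 : R) < n.+1%:R by rewrite ltr0n.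
have -> : exp_jet d n.+1 x = n.+1%:R^-1 *
    \sum_(k < n.+1) k.+1%:R * d k.+1 x * exp_jet d (n - k) x.
  by rewrite -exp_jetS mulrA mulVf ?mul1r// pnatr_eq0.
rewrite normcM normcV normc_nat mulrC ler_pdivrMr// mulrC.
set L := K * (C + 1).
have tele := @geometric_convolution C K L n ltac:(rewrite /L; ring).
have KL : 0 <= K by exact: ltW.
(* The weights [k + 1] are bounded by [n + 1], which the denominator of the recursion compensates;
   the remaining sum is [L^(n+1) - K^(n+1)]. *)
apply: (@le_trans _ _ (n.+1%:R * (expR C * \sum_(k < n.+1) C * K ^+ k.+1 * L ^+ (n - k)))).
  rewrite mulr_sumr mulr_sumr.
  have H m : (m <= n.+1)%N ->
    normc (\sum_(k < m) k.+1%:R * d k.+1 x * exp_jet d (n - k) x) <=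
    \sum_(k < m) n.+1%:R * (expR C * (C * K ^+ k.+1 * L ^+ (n - k))).
    elim: m => [_|m IHm mn]; first by rewrite !big_ord0 normc0.
    rewrite !big_ord_recr/= (le_trans (ler_normcD _ _))// lerD ?IHm ?(ltnW mn)//.
    rewrite !normcM normc_nat -mulrA ler_pM ?mulr_ge0 ?normc_ge0 ?ler_nat//.
    rewrite mulrCA ler_pM ?mulr_ge0 ?normc_ge0 ?dCK ?IH ?ltnS ?leq_subr//.
  exact: H.
rewrite ler_pM2l// ler_pM2l ?expR_gt0// tele gerBl exprn_ge0//.
Qed.

End analytic_exp.

(** * Identity theorem on an interval *)

Section identity_theorem.
Variable R : realType.
Implicit Types (F G : R -> R[i]) (x y a b t u v rho C K : R) (d e : nat -> R -> R[i]).

Lemma le0_of_derive_le0 (f f' : R -> R) a b :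
  a <= b -> (forall t, a <= t <= b -> is_derive t 1 f (f' t)) ->
  (forall t, a <= t <= b -> f' t <= 0) -> f a <= 0 -> f b <= 0.
Proof.
move=> ab df f'0 fa0; apply: (le_trans _ fa0).
have oc t : t \in `]a, b[%R -> a <= t <= b.
  by rewrite in_itv/= => /andP[/ltW -> /ltW ->].
apply: (@ler0_derive1_le_cc R f a b) => //.
- by move=> t /oc /df [].
- by move=> t /oc tab; have [_ e] := df _ tab; rewrite derive1E e f'0.
- apply: derivable_within_continuous => t; rewrite in_itv/= => /df.
  by case.
- by rewrite in_itv/= lexx ab.
- by rewrite in_itv/= lexx ab.
Qed.

(** Taylor remainder obtained by comparison instead of integration: the bound on [g (n + 1)] at
    order [k] controls the derivative of [g n], and its primitive vanishing at [a] is the bound at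
    order [k + 1], because [(k+1) C(n+k+1, k+1) = (n+1) C(n+k+1, k)]. *)
Lemma taylor_vanish (g : nat -> R -> R) a b C K :
  (forall n t, a <= t <= b -> is_derive t 1 (g n) (n.+1%:R * g n.+1 t)) ->
  (forall n t, a <= t <= b -> `|g n t| <= C * K ^+ n) ->
  (forall n, g n a = 0) -> 0 <= C -> 0 < K ->
  forall k n t, a <= t <= b ->
    `|g n t| <= C * K ^+ (n + k) * 'C(n + k, k)%:R * (t - a) ^+ k.
Proof.
move=> dg gb ga C0 K0; elim=> [|k IH] n t tab.
  by rewrite addn0 bin0 !mulr1 gb.
have [at_ tb] := andP tab.
pose B := C * K ^+ (n + k.+1) * 'C(n + k.+1, k.+1)%:R.
have sub u : a <= u <= t -> a <= u <= b.
  by move=> /andP[-> /=] /le_trans; apply.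
pose P u := C * K ^+ (n.+1 + k) * 'C(n.+1 + k, k)%:R * (u - a) ^+ k.
have dB u : is_derive u 1 (fun v => B * (v - a) ^+ k.+1) (n.+1%:R * P u).
  have d1 : is_derive u 1 (fun v => v - a) 1.
    apply: (is_derive_ext (is_deriveB (is_derive_id u 1) (is_derive_cst a u 1))) => //.
    by rewrite subr0.
  have := is_deriveZ B (is_deriveX k.+1 d1).
  move=> h; apply: (is_derive_ext h) => [v|]; first by rewrite !fctE.
  rewrite /GRing.scale /= mulr1 /B /P addSnnS.
  have : (k.+1 * 'C(n + k.+1, k.+1) = n.+1 * 'C(n + k.+1, k))%N.
    by rewrite mul_bin_left addnS -addSn addnK.
  move=> /(congr1 (fun m => m%:R : R)); rewrite !natrM => E.
  transitivity (C * K ^+ (n + k.+1) * (u - a) ^+ k * (k.+1%:R * 'C(n + k.+1, k.+1)%:R)).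
    by ring.
  by rewrite E; ring.
rewrite -/B ler_norml; apply/andP; split.
  rewrite -subr_ge0 opprK -oppr_le0 opprD.
  apply: (@le0_of_derive_le0 (fun v => - g n v - B * (v - a) ^+ k.+1)
    (fun u => - (n.+1%:R * g n.+1 u) - n.+1%:R * P u) a t at_).
  - move=> u aut; apply: is_deriveB (dB u).
    by apply: is_deriveN; exact: dg (sub _ aut).
  - move=> u aut; rewrite -mulrN -mulrBr pmulr_rle0 ?ltr0n// subr_le0.
    by have := IH n.+1 u (sub _ aut); rewrite ler_norml => /andP[]; rewrite lerNl.
  - by rewrite ga subrr expr0n /= mulr0 oppr0 addr0.
rewrite -subr_le0.
apply: (@le0_of_derive_le0 (fun v => g n v - B * (v - a) ^+ k.+1)
  (fun u => n.+1%:R * g n.+1 u - n.+1%:R * P u) a t at_).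
- move=> u aut; apply: is_deriveB (dB u).
  exact: dg (sub _ aut).
- move=> u aut; rewrite -mulrBr pmulr_rle0 ?ltr0n// subr_le0.
  by have := IH n.+1 u (sub _ aut); rewrite ler_norml => /andP[].
- by rewrite ga subrr expr0n /= mulr0 subr0.
Qed.

Lemma geometric_le0 (A x q : R) : 0 <= q < 1 ->
  (forall k : nat, x <= A * q ^+ k) -> x <= 0.
Proof.
move=> /andP[q0 q1] xA.
have qn : `|q| < 1 by rewrite ger0_norm.
have c : A * q ^+ k @[k --> \oo] --> (0 : R).
  by rewrite -(mulr0 A); apply: cvgM; [exact: cvg_cst|exact: cvg_expr].
have := limr_ge (@cvgP _ _ _ c) (nearW _ xA).
by rewrite (cvg_lim _ c)//; exact.
Qed.

Lemma leq_bin_exp2 n k : ('C(n, k) <= 2 ^ n)%N.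
Proof.
have [kn|nk] := leqP k n; last by rewrite bin_small.
have kn' : (k < n.+1)%N by [].
rewrite -[2%N]/(1 + 1)%N expnDn (bigD1 (Ordinal kn'))//=.
by rewrite !exp1n !muln1 leq_addr.
Qed.

(** Bounding the binomial by [2^(n+k)] turns the remainder into [C (2K)^n (2K (b - a))^k]. A step of
    at most [1/(4K)] makes the last ratio at most 1/2, and [k] is arbitrary. *)
Lemma taylor_vanish0 (g : nat -> R -> R) a b C K :
  (forall n t, a <= t <= b -> is_derive t 1 (g n) (n.+1%:R * g n.+1 t)) ->
  (forall n t, a <= t <= b -> `|g n t| <= C * K ^+ n) ->
  (forall n, g n a = 0) -> 0 <= C -> 0 < K -> a <= b -> K * (b - a) <= 4^-1 ->
  forall n, g n b = 0.
Proof.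
move=> dg gb ga C0 K0 ab Kb n; apply/eqP; rewrite -normr_le0.
apply: (@geometric_le0 (C * (2 * K) ^+ n) _ 2^-1).
  by rewrite invr_ge0 ler0n invf_lt1 ?ltr1n.
move=> k.
have bb : a <= b <= b by rewrite ab lexx.
rewrite (le_trans (taylor_vanish dg gb ga C0 K0 k n bb))//.
have K0' := ltW K0.
have ba : 0 <= b - a by rewrite subr_ge0.
apply: (@le_trans _ _ (C * K ^+ (n + k) * 2 ^+ (n + k) * (b - a) ^+ k)).
  rewrite ler_wpM2r ?exprn_ge0// ler_wpM2l ?mulr_ge0 ?exprn_ge0//.
  by rewrite -natrX ler_nat leq_bin_exp2.
have -> : C * K ^+ (n + k) * 2 ^+ (n + k) * (b - a) ^+ k =
    C * (2 * K) ^+ n * (2 * (K * (b - a))) ^+ k.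
  by rewrite !exprD !exprMn; ring.
rewrite ler_wpM2l ?mulr_ge0 ?exprn_ge0 ?mulr_ge0//.
rewrite lerXn2r ?nnegrE ?invr_ge0 ?mulr_ge0//.
by rewrite (le_trans (ler_wpM2l _ Kb))//; lra.
Qed.

Lemma analytic_jet_vanish_step rho d C K a b :
  (forall n x, `|x| < rho -> is_cderive (d n) x (n.+1%:R * d n.+1 x)) ->
  (forall n x, `|x| < rho -> normc (d n x) <= C * K ^+ n) ->
  0 < C -> 0 < K -> 0 <= a -> a <= b -> b < rho -> K * (b - a) <= 4^-1 ->
  (forall n, d n a = 0) -> forall n, d n b = 0.
Proof.
move=> dd dCK C0 K0 a0 ab brho Kb da n.
have abrho t : a <= t <= b -> `|t| < rho.
  move=> /andP[at_ tb]; rewrite ger0_norm ?(le_trans a0)//.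
  exact: le_lt_trans brho.
apply: complex_eqP.
- apply: (@taylor_vanish0 (fun n t => complex.Re (d n t)) a b C K) => //; last 2 first.
  + by move=> m; rewrite da.
  + exact: ltW.
  + move=> m t /abrho trho; have [h _] := dd m t trho.
    by apply: (is_derive_ext h) => //; rewrite ReM Re_nat Im_nat mul0r subr0.
  + move=> m t /abrho trho.
    by rewrite (le_trans (ler_Re_normc _))// dCK.
- apply: (@taylor_vanish0 (fun n t => complex.Im (d n t)) a b C K) => //; last 2 first.
  + by move=> m; rewrite da.
  + exact: ltW.
  + move=> m t /abrho trho; have [_ h] := dd m t trho.
    by apply: (is_derive_ext h) => //; rewrite ImM Re_nat Im_nat mul0r addr0.
  + move=> m t /abrho trho.
    by rewrite (le_trans (ler_Im_normc _))// dCK.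
Qed.

Lemma is_derive_near0 (f : R -> R) x (l : R) (e : R) : 0 < e ->
  (forall t, `|t - x| < e -> f t = 0) -> is_derive x 1 f l -> l = 0.
Proof.
move=> e0 f0 fl.
have near_f : \forall t \near x, f t = (cst 0 : R -> R) t.
  near=> t; apply: f0; near: t.
  by apply: (@cvgr_distC_lt _ _ _ (nbhs x) _ id x) => //; exact: cvg_id.
have [_ <-] := near_eq_is_derive near_f fl.
by have [_ ->] := @is_derive_cst _ _ _ (0 : R) x 1.
Unshelve. all: by end_near. Qed.

(** Near 0 all coefficients vanish, by successive differentiation of the zero function. As [K]
    serves on the whole interval, vanishing then moves to the right in steps of the fixed length
    [1/(4K)] and reaches every point below [rho]. *)
Lemma identity_theorem rho F eps : 0 < eps -> 0 < rho ->
  analytic_on rho F -> (forall x, `|x| < eps -> F x = 0) ->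
  forall x, 0 <= x < rho -> F x = 0.
Proof.
move=> eps0 rho0 [d [dd [C [K [C0 K0 dCK]]]] dF] F0.
have d0 n x : `|x| < Num.min eps rho -> d n x = 0.
  elim: n x => [|n IH] x xer; have := xer; rewrite lt_min => /andP[xe xrho].
    by rewrite dF// F0.
  have e0 : 0 < Num.min eps rho - `|x| by rewrite subr_gt0.
  have near0 t : `|t - x| < Num.min eps rho - `|x| -> d n t = 0.
    move=> tx; apply: IH; rewrite -(subrK x t).
    by rewrite (le_lt_trans (ler_normD _ _))// -ltrBrDr.
  have [re im] := dd n x xrho.
  have nz : (n.+1%:R : R) != 0 by rewrite pnatr_eq0.
  apply: complex_eqP.
    have := is_derive_near0 e0 (fun t ht => congr1 (@complex.Re R) (near0 t ht)) re.
    rewrite ReM Re_nat Im_nat mul0r subr0 => /eqP.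
    by rewrite mulf_eq0 (negbTE nz) => /eqP ->.
  have := is_derive_near0 e0 (fun t h => congr1 (@complex.Im R) (near0 t h)) im.
  rewrite ImM Re_nat Im_nat mul0r addr0 => /eqP.
  by rewrite mulf_eq0 (negbTE nz) => /eqP ->.
pose h := (4 * K)^-1.
have h0 : 0 < h by rewrite invr_gt0 mulr_gt0.
have steps m y : 0 <= y < rho -> y <= m%:R * h -> forall n, d n y = 0.
  elim: m y => [|m IH] y /andP[y0 yrho] ym n.
    have -> : y = 0 by apply/eqP; rewrite eq_le y0 andbT (le_trans ym)// mul0r.
    by apply: d0; rewrite normr0 lt_min eps0.
  have [ymh|mhy] := leP y (m%:R * h); first by apply: IH => //; rewrite y0.
  have mh0 : 0 <= m%:R * h by rewrite mulr_ge0// ltW.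
  apply: (@analytic_jet_vanish_step rho d C K (m%:R * h)) => //.
  - exact: ltW.
  - apply: (@le_trans _ _ (K * h)).
      by rewrite ler_pM2l// lerBlDl (le_trans ym)// -natr1 mulrDl mul1r.
    by rewrite /h invfM mulrCA divff ?mulr1// gt_eqF.
  - by apply: IH => //; rewrite mh0 (lt_trans mhy).
move=> x /andP[x0 xrho].
rewrite -dF; last by rewrite ger0_norm.
apply: (@steps (Num.trunc (x / h)).+1); first by rewrite x0.
by rewrite -ler_pdivrMr// ltW// truncnS_gt.
Qed.

End identity_theorem.

(** * Integration on the circle *)

Section complex_integral.
Variable R : realType.
Local Notation T := (borel_circle R).
Implicit Types (F G : T -> R[i]).

Lemma circle_continuous_measurable (g : circle R -> R) :
  continuous g -> measurable_fun setT (g : T -> R).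
Proof.
move=> cg; apply: (measurability _ (RGenOInfty.measurableE R)).
move=> /= _ [_ [a ->]] <-; rewrite setTI; apply: sub_sigma_algebra => /=.
by apply: open_comp => // u _; exact: cg.
Qed.

Lemma normc_lt_ball (z w : Cx R) (e : R) :
  `|z - w| < e%:C -> normc ((z : R[i]) - w) < e.
Proof. by rewrite ltcR. Qed.

Lemma continuous_Re : continuous (fun z : Cx R => complex.Re (z : R[i]) : R).
Proof.
move=> z; apply: (cvgrPdist_lt (F := nbhs (z : Cx R)) _ _).2 => /= e e0.
have e0' : (0 : R[i]) < e%:C by rewrite ltcR.
apply: (@filterS _ (nbhs (z : Cx R)) _ _ _ _ (@nbhsx_ballx _ (Cx R) z _ e0')) => w zw.
rewrite -ReN -ReD (le_lt_trans (ler_Re_normc _))//.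
exact: normc_lt_ball.
Qed.

Lemma continuous_Im : continuous (fun z : Cx R => complex.Im (z : R[i]) : R).
Proof.
move=> z; apply: (cvgrPdist_lt (F := nbhs (z : Cx R)) _ _).2 => /= e e0.
have e0' : (0 : R[i]) < e%:C by rewrite ltcR.
apply: (@filterS _ (nbhs (z : Cx R)) _ _ _ _ (@nbhsx_ballx _ (Cx R) z _ e0')) => w zw.
rewrite -ImN -ImD (le_lt_trans (ler_Im_normc _))//.
exact: normc_lt_ball.
Qed.

Lemma continuous_cval : continuous (@cval R : circle R -> Cx R).
Proof. exact: initial_continuous. Qed.

Definition cmeasurable F := measurable_fun setT (fun u => complex.Re (F u)) /\
  measurable_fun setT (fun u => complex.Im (F u)).

Lemma cmeasurable_cval : cmeasurable (fun u : T => cval u).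
Proof.
split.
- apply: (@circle_continuous_measurable (fun u => complex.Re (cval u))) => u.
  exact: (continuous_comp (@continuous_cval u) (@continuous_Re _)).
- apply: (@circle_continuous_measurable (fun u => complex.Im (cval u))) => u.
  exact: (continuous_comp (@continuous_cval u) (@continuous_Im _)).
Qed.

Lemma cmeasurable_cst (c : R[i]) : cmeasurable (fun=> c).
Proof. by split; exact: measurable_cst. Qed.

Lemma cmeasurableD F G : cmeasurable F -> cmeasurable G ->
  cmeasurable (fun u => F u + G u).
Proof.
move=> [F1 F2] [G1 G2]; split.
- under eq_fun do rewrite ReD; exact: measurable_funD.
- under eq_fun do rewrite ImD; exact: measurable_funD.
Qed.

Lemma cmeasurableM F G : cmeasurable F -> cmeasurable G ->
  cmeasurable (fun u => F u * G u).
Proof.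
move=> [F1 F2] [G1 G2]; split.
- under eq_fun do rewrite ReM; apply: measurable_funB; exact: measurable_funM.
- under eq_fun do rewrite ImM; apply: measurable_funD; exact: measurable_funM.
Qed.

Lemma cmeasurableX F n : cmeasurable F -> cmeasurable (fun u => F u ^+ n).
Proof.
move=> mF; elim: n => [|n IH]; first exact: cmeasurable_cst.
have -> : (fun u => F u ^+ n.+1) = (fun u => F u * F u ^+ n).
  by apply/funext => u; rewrite exprS.
exact: cmeasurableM.
Qed.

Lemma cmeasurableV F : cmeasurable F -> cmeasurable (fun u => (F u)^-1).
Proof.
move=> [F1 F2].
(* The real power is measurable on the whole line; on nonnegative bases the exponent -1 agrees with
   the inverse, including the default value 0 at 0. *)
pose N u := (complex.Re (F u) ^+ 2 + complex.Im (F u) ^+ 2) `^ (-1).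
have mN : measurable_fun setT N.
  apply: (measurableT_comp (measurable_powR _)).
  by apply: measurable_funD; exact: measurable_funX.
have VE u : (F u)^-1 =
    (complex.Re (F u) * N u) +i* ((- complex.Im (F u)) * N u).
  rewrite /N powR_inv1 ?addr_ge0 ?sqr_ge0//.
  by case: (F u) => a b /=; rewrite mulNr.
split.
- under eq_fun do rewrite VE; exact: measurable_funM.
- under eq_fun do rewrite VE; apply: measurable_funM => //.
  exact: measurableT_comp.
Qed.

Variable mu : probability T R.

(** Boundedness implies integrability under a probability measure, and all integrands met here are
    bounded. *)
Definition cintegrable F := cmeasurable F /\ exists M : R, forall u, normc (F u) <= M.

Lemma bounded_integrable (f : T -> R) (M : R) : measurable_fun setT f ->
  (forall u, `|f u| <= M) -> mu.-integrable setT (EFin \o f).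
Proof.
move=> mf fM; apply: measurable_bounded_integrable => //.
  by rewrite (le_lt_trans (probability_le1 _ _))// ltry.
exists M; split; first by rewrite num_real.
by move=> x Mx u _; exact: (le_trans (fM u) (ltW Mx)).
Qed.

Lemma cintegrable_ReIm F : cintegrable F ->
  mu.-integrable setT (EFin \o (fun u => complex.Re (F u))) /\
  mu.-integrable setT (EFin \o (fun u => complex.Im (F u))).
Proof.
move=> [[F1 F2] [M FM]]; split; apply: (@bounded_integrable _ M) => // u.
- exact: le_trans (ler_Re_normc _) (FM u).
- exact: le_trans (ler_Im_normc _) (FM u).
Qed.

Lemma CintegralD F G : cintegrable F -> cintegrable G ->
  Cintegral mu (fun u => F u + G u) = Cintegral mu F + Cintegral mu G.
Proof.
move=> /cintegrable_ReIm[F1 F2] /cintegrable_ReIm[G1 G2].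
apply: complex_eqP; rewrite /Cintegral /=.
- by under eq_Rintegral => u _ do rewrite ReD; rewrite RintegralD.
- by under eq_Rintegral => u _ do rewrite ImD; rewrite RintegralD.
Qed.

Lemma CintegralZ (c : R[i]) F : cintegrable F ->
  Cintegral mu (fun u => c * F u) = c * Cintegral mu F.
Proof.
move=> /cintegrable_ReIm[F1 F2].
have Z (r : R) (f : T -> R) : mu.-integrable setT (EFin \o f) ->
    mu.-integrable setT (EFin \o (fun u => r * f u)).
  by move=> fi; exact: (integrableZl measurableT r fi).
apply: complex_eqP; rewrite ?(ReM, ImM) /Cintegral /=.
- under eq_Rintegral => u _ do rewrite ReM.
  by rewrite RintegralB ?RintegralZl//; exact: Z.
- under eq_Rintegral => u _ do rewrite ImM.
  by rewrite RintegralD ?RintegralZl//; exact: Z.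
Qed.

Lemma Rintegral_probability_cst (r : R) : \int[mu]_u (fun=> r) u = r.
Proof.
rewrite Rintegral_cst// -[RHS]mulr1; congr (_ * _).
exact: (congr1 fine (@probability_setT _ _ _ mu)).
Qed.

Lemma Cintegral_cst (c : R[i]) : Cintegral mu (fun=> c) = c.
Proof.
by apply: complex_eqP; rewrite /= Rintegral_probability_cst.
Qed.

Lemma cintegrable_cst (c : R[i]) : cintegrable (fun=> c).
Proof. by split; [exact: cmeasurable_cst|exists (normc c)]. Qed.

Lemma cintegrableD F G : cintegrable F -> cintegrable G ->
  cintegrable (fun u => F u + G u).
Proof.
move=> [mF [M FM]] [mG [N GN]]; split; first exact: cmeasurableD.
by exists (M + N) => u; rewrite (le_trans (ler_normcD _ _))// lerD.
Qed.

Lemma cintegrableZ (c : R[i]) F : cintegrable F -> cintegrable (fun u => c * F u).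
Proof.
move=> [mF [M FM]]; split.
  by apply: cmeasurableM => //; exact: cmeasurable_cst.
by exists (normc c * M) => u; rewrite normcM ler_wpM2l ?normc_ge0.
Qed.

Lemma Rintegral_bound (f : T -> R) (M : R) : measurable_fun setT f ->
  (forall u, `|f u| <= M) -> `|\int[mu]_u f u| <= M.
Proof.
move=> mf fM; have fi := bounded_integrable mf fM.
rewrite (le_trans (le_normr_Rintegral measurableT fi))//.
have /le_trans -> // : \int[mu]_u `|f u| <= \int[mu]_u (cst M u).
  apply: le_Rintegral => //.
  - by apply: (@bounded_integrable _ M) => [|u]; [exact: measurableT_comp|rewrite normr_id].
  - by apply: (@bounded_integrable _ `|M|) => [|u]; [exact: measurable_cst|].
by rewrite Rintegral_probability_cst.
Qed.

(** The factor 2 comes from bounding the two coordinates separately; its uses only require some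
    finite constant. *)
Lemma normc_Cintegral F (M : R) : cmeasurable F -> (forall u, normc (F u) <= M) ->
  normc (Cintegral mu F) <= 2 * M.
Proof.
move=> [F1 F2] FM; rewrite (le_trans (ler_normc_ReIm _))// mulr2n mulrDl !mul1r.
apply: lerD; apply: Rintegral_bound => // u.
- exact: le_trans (ler_Re_normc _) (FM u).
- exact: le_trans (ler_Im_normc _) (FM u).
Qed.

End complex_integral.

(** * Resolvent moments along a ray and their analyticity *)

Section resolvent.
Variable R : realType.

(** A second-order remainder that is uniform in the integration variable survives integration, so
    this criterion does the work of differentiation under the integral sign. *)
Lemma is_derive_of_quadratic (f : R -> R) (x l e C : R) : 0 < e -> 0 <= C ->
  (forall y, `|y| < e -> `|f (x + y) - f x - y * l| <= C * y ^+ 2) ->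
  is_derive x 1 f l.
Proof.
move=> e0 C0 fl.
suff c : (fun h : R => h^-1 *: ((f \o shift x) (h *: (1 : R)) - f x)) @ 0^' --> l.
  split; first by apply/cvg_ex; exists l.
  exact: cvg_lim c.
apply/cvgrPdist_le => /= eps eps0.
have C1 : 0 < C + 1 by rewrite ltr_wpDl.
have m0 : 0 < Num.min e (eps / (C + 1)) by rewrite lt_min e0 divr_gt0.
near=> h.
have h0 : h != 0 by near: h; exact: nbhs_dnbhs_neq.
have : `|h| < Num.min e (eps / (C + 1)).
  by near: h; apply: dnbhs0_lt.
rewrite lt_min => /andP[he hC].
have -> : l - h^-1 *: (f (h *: 1 + x) - f x) = - (h^-1 * (f (x + h) - f x - h * l)).
  rewrite /GRing.scale /= mulr1 (addrC h x).
  by field.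
rewrite normrN normrM normfV ler_pdivrMl ?normr_gt0//.
rewrite (le_trans (fl _ he))// -(real_normK (num_real h)) expr2 mulrCA.
rewrite ler_wpM2l// (le_trans _ (_ : (C + 1) * `|h| <= eps))//.
  by rewrite ler_wpM2r// lerDl.
by rewrite -ler_pdivlMl// mulrC ltW.
Unshelve. all: by end_near. Qed.

Lemma is_cderive_of_quadratic (F : R -> R[i]) (x e C : R) (l : R[i]) :
  0 < e -> 0 <= C ->
  (forall y, `|y| < e -> normc (F (x + y) - F x - y%:C * l) <= C * y ^+ 2) ->
  is_cderive F x l.
Proof.
move=> e0 C0 Fl; split; apply: (is_derive_of_quadratic e0 C0) => y ye.
- apply: le_trans (Fl y ye); apply: le_trans (ler_Re_normc _).
  by rewrite !ReD !ReN ReM /= mul0r subr0.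
- apply: le_trans (Fl y ye); apply: le_trans (ler_Im_normc _).
  by rewrite !ImD !ImN ImM /= mul0r addr0.
Qed.

(* [b - a = t a b] is the resolvent identity for [a = 1/(1 - v r)],
   [b = 1/(1 - v (r + y))] and [t = y v]. *)
Lemma resolvent_taylor (K : R) m : exists2 C, 0 <= C &
  forall a b t : R[i], normc a <= K -> normc b <= K -> b - a = t * a * b ->
    normc (b ^+ m - a ^+ m - m%:R * t * a ^+ m.+1) <= C * normc t ^+ 2.
Proof.
elim: m => [|m [C C0 IH]].
  exists 0 => // a b t _ _ _.
  by rewrite !expr0 subrr !mul0r subrr normc0.
exists (`|K| * C + m.+1%:R * `|K| ^+ m.+3).
  by apply: addr_ge0; apply: mulr_ge0; rewrite ?exprn_ge0 ?ler0n.
move=> a b t aK bK ba.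
have -> : b ^+ m.+1 - a ^+ m.+1 - m.+1%:R * t * a ^+ m.+2 =
    b * (b ^+ m - a ^+ m - m%:R * t * a ^+ m.+1) +
    m.+1%:R * t ^+ 2 * (a ^+ m.+2 * b).
  rewrite -[RHS]addr0 -(mul0r (a ^+ m + m.+1%:R * t * a ^+ m.+1)).
  rewrite -(subrr (t * a * b)) -{1}ba !exprS -natr1; ring.
have aK' : normc a <= `|K| by rewrite (le_trans aK)// ler_norm.
have bK' : normc b <= `|K| by rewrite (le_trans bK)// ler_norm.
rewrite (le_trans (ler_normcD _ _))// mulrDl; apply: lerD.
  rewrite normcM -[leRHS]mulrA; apply: ler_pM; rewrite ?normc_ge0//.
  by apply: IH.
rewrite normcM [normc (_ * t ^+ 2)]normcM normc_nat [normc (t ^+ 2)]normcX.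
rewrite [normc (_ * b)]normcM [normc (a ^+ _)]normcX mulrAC.
rewrite ler_wpM2r ?sqr_ge0// ler_wpM2l ?ler0n//.
rewrite [leRHS]exprSr; apply: ler_pM; rewrite ?exprn_ge0 ?normc_ge0//.
by rewrite lerXn2r ?nnegrE ?normc_ge0.
Qed.

Lemma normc_cval (u : circle R) : normc (cval u) = 1.
Proof.
have := set_valP u; rewrite /unit_circle /=.
by move=> /(congr1 (@complex.Re R)).
Qed.

Variables (mu : probability (borel_circle R) R) (om : R[i]).
Hypothesis om1 : normc om = 1.

Let v (u : borel_circle R) := cval u * om.

Let v1 u : normc (v u) = 1.
Proof. by rewrite normcM normc_cval om1 mulr1. Qed.

Definition resolvent (r : R) (u : borel_circle R) : R[i] := (1 - v u * r%:C)^-1.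

Lemma normc_resolvent_denominator r u : 1 - `|r| <= normc (1 - v u * r%:C).
Proof.
rewrite lerBlDr -{1}(normc1 R) -{1}(subrK (v u * r%:C) 1).
by rewrite (le_trans (ler_normcD _ _))// normcM v1 mul1r normc_real.
Qed.

Lemma resolvent_denominator_neq0 r u : `|r| < 1 -> 1 - v u * r%:C != 0.
Proof.
move=> r1; apply/eqP => E.
by have := normc_resolvent_denominator r u; rewrite E normc0 leNgt subr_gt0 r1.
Qed.

Lemma normc_resolvent rho r u : rho < 1 -> `|r| <= rho ->
  normc (resolvent r u) <= (1 - rho)^-1.
Proof.
move=> rho1 rrho; have r1 := le_lt_trans rrho rho1.
have h := normc_resolvent_denominator r u.
rewrite normcV lef_pV2 ?posrE ?subr_gt0//.
- by rewrite (le_trans _ h)// lerB.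
- by rewrite (lt_le_trans _ h)// subr_gt0.
Qed.

Lemma resolvent_identity r y u : `|r| < 1 -> `|r + y| < 1 ->
  resolvent (r + y) u - resolvent r u =
  y%:C * v u * resolvent r u * resolvent (r + y) u.
Proof.
move=> r1 ry1; rewrite /resolvent.
have n1 := resolvent_denominator_neq0 u r1.
have n2 := resolvent_denominator_neq0 u ry1.
move: n1 n2; rewrite rmorphD /=; move: (y%:C) (r%:C) (v u) => Y Z V n1 n2.
by field; rewrite n1 n2.
Qed.

(** The [n]-th derivative of [1 / (1 - v r)] in [r], divided by [n!]. *)
Definition qterm n r (u : borel_circle R) := v u ^+ n * resolvent r u ^+ n.+1.

Lemma cmeasurable_resolvent r : cmeasurable (resolvent r).
Proof.
apply: cmeasurableV; apply: cmeasurableD; first exact: cmeasurable_cst.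
have -> : (fun u => - (v u * r%:C)) = (fun u => cval u * (om * - r%:C)).
  by apply/funext => u; rewrite /v; ring.
by apply: cmeasurableM; [exact: cmeasurable_cval|exact: cmeasurable_cst].
Qed.

Lemma cmeasurable_qterm n r : cmeasurable (qterm n r).
Proof.
apply: cmeasurableM; apply: cmeasurableX; last exact: cmeasurable_resolvent.
by apply: cmeasurableM; [exact: cmeasurable_cval|exact: cmeasurable_cst].
Qed.

Lemma normc_qterm n rho r u : rho < 1 -> `|r| <= rho ->
  normc (qterm n r u) <= (1 - rho)^-1 ^+ n.+1.
Proof.
move=> rho1 rrho; rewrite normcM !normcX v1 expr1n mul1r.
rewrite lerXn2r ?nnegrE ?normc_ge0 ?invr_ge0 ?subr_ge0 ?(ltW rho1)//.
exact: normc_resolvent.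
Qed.

Lemma cintegrable_qterm n r : `|r| < 1 -> cintegrable (qterm n r).
Proof.
move=> r1; split; first exact: cmeasurable_qterm.
by exists ((1 - `|r|)^-1 ^+ n.+1) => u; exact: normc_qterm.
Qed.

(** For [n = 0] this is [1 + psi (om r)], the moment generating function along the ray of direction
    [om]; the whole sequence is its jet. *)
Definition Qmoment n r := Cintegral mu (qterm n r).

Lemma is_cderive_Qmoment n r : `|r| < 1 ->
  is_cderive (Qmoment n) r (n.+1%:R * Qmoment n.+1 r).
Proof.
move=> r1.
(* Strictly between [|r|] and 1, so that [r] and its perturbations share one resolvent bound. *)
pose rho := (1 + `|r|) / 2.
have rho1 : rho < 1 by rewrite /rho; lra.
have rrho : `|r| <= rho by rewrite /rho; lra.
have [C C0 HC] := resolvent_taylor (1 - rho)^-1 n.+1.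
apply: (@is_cderive_of_quadratic _ _ (rho - `|r|) (2 * C)).
- by rewrite /rho; lra.
- by rewrite mulr_ge0.
move=> y ye.
have ryrho : `|r + y| <= rho.
  by rewrite (le_trans (ler_normD _ _))// -lerBrDl ltW.
have ry1 := le_lt_trans ryrho rho1.
(* The pointwise remainder of [qterm n]; since [|v| = 1], only the remainder of a resolvent power is
   left, which [resolvent_taylor] bounds with [t = y v]. *)
pose E u := v u ^+ n * (resolvent (r + y) u ^+ n.+1 - resolvent r u ^+ n.+1 -
  n.+1%:R * (y%:C * v u) * resolvent r u ^+ n.+2).
have iq1 := cintegrable_qterm n ry1.
have iq2 := cintegrable_qterm n r1.
have iq3 := cintegrable_qterm n.+1 r1.
have EE : E = fun u => (qterm n (r + y) u + (-1) * qterm n r u) +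
    (- (y%:C * n.+1%:R)) * qterm n.+1 r u.
  by apply/funext => u; rewrite /E /qterm !exprS; ring.
have -> : Qmoment n (r + y) - Qmoment n r - y%:C * (n.+1%:R * Qmoment n.+1 r) =
    Cintegral mu E.
  have i2 := cintegrableZ (-1) iq2; have i3 := cintegrableZ (- (y%:C * n.+1%:R)) iq3.
  rewrite EE (CintegralD mu (cintegrableD iq1 i2) i3) (CintegralD mu iq1 i2).
  rewrite (CintegralZ mu _ iq2) (CintegralZ mu _ iq3) /Qmoment.
  move: (Cintegral _ _) (Cintegral _ _) (Cintegral _ _) => I1 I2 I3; ring.
have iE : cintegrable E.
  rewrite EE; apply: cintegrableD; last exact: cintegrableZ.
  by apply: cintegrableD => //; exact: cintegrableZ.
rewrite -mulrA; apply: normc_Cintegral => [|u]; first by case: iE.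
rewrite /E normcM normcX v1 expr1n mul1r.
have := HC (resolvent r u) (resolvent (r + y) u) (y%:C * v u)
  (normc_resolvent u rho1 rrho) (normc_resolvent u rho1 ryrho)
  (resolvent_identity u r1 ry1).
by rewrite [normc (y%:C * _)]normcM v1 mulr1 normc_real real_normK ?num_real.
Qed.

Lemma analytic_on_Qmoment rho : 0 <= rho < 1 -> analytic_on rho (Qmoment 0).
Proof.
move=> /andP[rho0 rho1]; exists Qmoment => //.
have K0 : 0 < (1 - rho)^-1 by rewrite invr_gt0 subr_gt0.
split=> [n r rrho|].
  by apply: is_cderive_Qmoment; exact: lt_trans rho1.
exists (2 * (1 - rho)^-1), (1 - rho)^-1; split => //.
  by rewrite mulr_gt0.
move=> n r rrho; rewrite -mulrA -exprS; apply: normc_Cintegral.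
  exact: cmeasurable_qterm.
by move=> u; apply: normc_qterm => //; exact: ltW.
Qed.

End resolvent.

(** * From the S-transform to the functional equation *)

Section functional_equation.
Variable R : realType.

Lemma near0_normc (P : R[i] -> Prop) : (\forall z \near (0 : Cx R), P z) ->
  exists2 e : R, 0 < e & forall z, normc z < e -> P z.
Proof.
move=> /(@nbhs_ballP _ (Cx R)) [e /= e0 eP].
move: e0; rewrite ltcE /= => /andP[/eqP ime e0].
exists (complex.Re e) => // z ze; apply: eP.
rewrite /ball /= sub0r normrN.
have -> : e = (complex.Re e)%:C by apply: complex_eqP.
by rewrite ltcR.
Qed.

Variables (mu : probability (borel_circle R) R) (s : R).
Hypothesis mu_s : free_unitary_normal s mu.

Lemma psi_transform_Qmoment (om : R[i]) (r : R) : normc om = 1 -> `|r| < 1 ->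
  psi_transform mu (om * r%:C) = Qmoment mu om 0 r - 1.
Proof.
move=> om1 r1.
rewrite /psi_transform.
have -> : (fun u => cval u * (om * r%:C) / (1 - cval u * (om * r%:C))) =
    fun u => qterm om 0 r u + (- 1 : R[i]).
  apply/funext => u; rewrite /qterm expr0 mul1r expr1 /resolvent.
  have := resolvent_denominator_neq0 om1 u r1.
  rewrite -mulrA => n0; field.
  exact: n0.
apply: (etrans (CintegralD mu (cintegrable_qterm om1 0 r1) (cintegrable_cst _))).
by rewrite Cintegral_cst.
Qed.

(** Brings [psi z] into the neighbourhood of 0 where the S-transform formula holds, and yields
    [psi 0 = 0]. *)
Lemma normc_psi_transform (z : R[i]) : normc z <= 2^-1 ->
  normc (psi_transform mu z) <= 4 * normc z.
Proof.
move=> z2; have -> : 4 * normc z = 2 * (2 * normc z) by ring.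
have den (u : borel_circle R) : 2^-1 <= normc (1 - cval u * z).
  have : normc (1 : R[i]) <= normc (1 - cval u * z) + normc (cval u * z).
    by rewrite -{1}(subrK (cval u * z) 1) ler_normcD.
  by rewrite normc1 normcM normc_cval mul1r; lra.
apply: normc_Cintegral => [|u].
  have mz : cmeasurable (fun u : borel_circle R => cval u * z).
    by apply: cmeasurableM; [exact: cmeasurable_cval|exact: cmeasurable_cst].
  apply: cmeasurableM => //; apply: cmeasurableV.
  apply: cmeasurableD; first exact: cmeasurable_cst.
  have -> : (fun u : borel_circle R => - (cval u * z)) = (fun u => (-1) * (cval u * z)).
    by apply/funext => u; rewrite mulN1r.
  by apply: cmeasurableM => //; exact: cmeasurable_cst.
rewrite normcM normcM normcV normc_cval mul1r mulrC ler_wpM2r ?normc_ge0//.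
rewrite -[leRHS]invrK lef_pV2 ?posrE//.
exact: lt_le_trans (den u).
Qed.

(** The S-transform formula is taken at [w = psi z], where [g w = z]. This [w] lies in the punctured
    neighbourhood: [w = 0] would give [z = g 0 = 0]. *)
Lemma psi_transform_germ : exists2 e : R, 0 < e & forall z, normc z < e -> z != 0 ->
  (1 + psi_transform mu z) * z =
  psi_transform mu z * cexp (s%:C * (psi_transform mu z + 2^-1)).
Proof.
have [_ [g [g0 _ _ gpsi] Sg]] := mu_s.
have {gpsi} [e1 e10 gpsi] := near0_normc gpsi.
have {Sg} [e2 e20 Sg] := near0_normc Sg.
have m0 : 0 < Num.min (Num.min e1 (e2 / 4)) 2^-1.
  by rewrite !lt_min e10 divr_gt0//= invr_gt0.
exists (Num.min (Num.min e1 (e2 / 4)) 2^-1) => // z.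
rewrite !lt_min => /andP[/andP[ze1 ze2] z2] z0.
have gz := gpsi z ze1.
set w := psi_transform mu z in gz *.
have w0 : w != 0 by apply: contra_neq z0 => w0; rewrite -gz w0 g0.
have we2 : normc w < e2.
  rewrite (le_lt_trans (normc_psi_transform (ltW z2)))//.
  by rewrite mulrC -ltr_pdivlMr.
have -> : cexp (s%:C * (w + 2^-1)) = (1 + w) / w * g w by exact: Sg.
by rewrite gz; field.
Qed.

Lemma functional_equation (t r : R) : 0 <= r < 1 ->
  let Q := Qmoment mu (cis t) 0 r in
  r%:C * cis t * Q = (Q - 1) * cexp (s%:C * (Q - 2^-1)).
Proof.
move=> /andP[r0 r1] Q.
(* With denominators cleared and subtractions written through the factor -1, [F] is built from sums,
   products and [cexp] only. *)
pose F x := x%:C * cis t * Qmoment mu (cis t) 0 x +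
  (-1) * ((Qmoment mu (cis t) 0 x + (-1)) *
    cexp (s%:C * (Qmoment mu (cis t) 0 x + - 2^-1))).
suff F0 : F r = 0.
  by apply/eqP; rewrite -subr_eq0; apply/eqP; rewrite -F0 /F mulN1r.
have om1 := normc_cis t.
pose rho := (1 + r) / 2.
have rho01 : 0 <= rho < 1 by rewrite /rho; lra.
have aQ := analytic_on_Qmoment mu om1 rho01.
have aF : analytic_on rho F.
  have aC c := @analytic_on_cst R rho c.
  apply: analytic_onD.
    by apply: analytic_onM => //; apply: analytic_onM => //; exact: analytic_on_real.
  apply: analytic_onM => //; apply: analytic_onM; first exact: analytic_onD.
  apply: analytic_on_cexp; apply: analytic_onM => //; exact: analytic_onD.
have [e e0 germ] := psi_transform_germ.
apply: (@identity_theorem _ rho F (Num.min e 1)) => //.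
- by rewrite lt_min e0 ltr01.
- by rewrite /rho; lra.
- move=> x; rewrite lt_min => /andP[xe x1].
  have psiE := psi_transform_Qmoment om1 x1.
  have Q1 : Qmoment mu (cis t) 0 x = 1 + psi_transform mu (cis t * x%:C).
    by rewrite psiE; ring.
  (* The germ excludes [z = 0]; there [F] vanishes because [psi 0 = 0]. *)
  have [x0|x0] := eqVneq x 0.
    rewrite /F Q1 x0 /= mulr0.
    have -> : psi_transform mu 0 = 0.
      apply: eq0_normc; apply/eqP; rewrite eq_le normc_ge0 andbT.
      have := @normc_psi_transform 0; rewrite normc0 mulr0; apply.
      by rewrite invr_ge0.
    by rewrite addr0 subrr !mul0r mulr0 addr0.
  have z0 : cis t * x%:C != 0.
    apply/eqP => /(congr1 (@normc R)); rewrite normcM om1 mul1r normc_real normc0.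
    by move/eqP; rewrite normr_eq0 (negbTE x0).
  have ze : normc (cis t * x%:C) < e by rewrite normcM om1 mul1r normc_real.
  have := germ _ ze z0.
  rewrite /F Q1; move: (psi_transform mu _) => w E.
  have -> : 1 + w - 2^-1 = w + 2^-1.
    by rewrite addrAC [RHS]addrC; congr (_ + _); field.
  rewrite [1 + w + -1]addrAC subrr add0r -E; ring.
- by rewrite /rho; lra.
Qed.

End functional_equation.

(** * Small-variance asymptotics *)

Section second_order_bounds.
Variable R : realType.
Implicit Types (a b : R) (z : R[i]).

(** Only [1 + t <= e^t] is used: at [t = -a] it gives [e^a (1 - a) <= 1], while [(1 + a + 2 a^2)(1 -
    a) = 1 + a^2 (1 - 2a)] is at least 1. *)
Lemma expR_second_order a : `|a| <= 2^-1 -> `|expR a - 1 - a| <= 2 * a ^+ 2.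
Proof.
rewrite ler_norml => /andP[a1 a2].
have h1 := expR_ge1Dx a; have h2 := expR_ge1Dx (- a).
rewrite ger0_norm; last by lra.
have ea : expR a * expR (- a) = 1 by rewrite -expRD subrr expR0.
have e0 := expR_gt0 a.
have h3 : expR a * (1 - a) <= 1 by rewrite -[leRHS]ea ler_pM2l.
have a0 : 0 < 1 - a by lra.
rewrite -(ler_pM2r a0).
have : 0 <= a ^+ 2 * (1 - 2 * a) by rewrite mulr_ge0 ?sqr_ge0//; lra.
rewrite !expr2 => h4; lra.
Qed.

Lemma expR_le2 a : `|a| <= 2^-1 -> expR a <= 2.
Proof.
move=> a2; have := expR_second_order a2; move: a2.
rewrite !ler_norml => /andP[a1 a2] /andP[_].
have : a ^+ 2 <= 2^-1 * 2^-1 by rewrite expr2; nra.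
lra.
Qed.

Lemma sin_le b : 0 <= b -> sin b <= b.
Proof.
move=> b0; rewrite -subr_le0.
apply: (@le0_of_derive_le0 R (fun t => sin t - t) (fun t => cos t - 1) 0 b) => //.
by rewrite sin0 subr0 lexx.
Qed.

Lemma normr_sin_le b : `|sin b| <= `|b|.
Proof.
have H (c : R) : 0 <= c -> `|sin c| <= c.
  move=> c0; rewrite ler_norml sin_le// andbT lerNl -subr_le0.
  apply: (@le0_of_derive_le0 R (fun t => - sin t - t) (fun t => - cos t - 1) 0 c) => //.
  by rewrite sin0 oppr0 addr0 lexx.
have [b0|b0] := leP 0 b; first by rewrite (ger0_norm b0) H.
by rewrite -{1}(opprK b) sinN normrN [leRHS]ltr0_norm// H// oppr_ge0 ltW.
Qed.

Lemma cos_second_order b : `|cos b - 1| <= b ^+ 2 / 2.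
Proof.
have -> : cos b - 1 = - (sin (b / 2) ^+ 2 *+ 2).
  by rewrite {1}(splitr b) cosD -!expr2 cos2sin2; ring.
rewrite normrN ger0_norm ?mulrn_wge0 ?sqr_ge0//.
have : sin (b / 2) ^+ 2 <= (b / 2) ^+ 2.
  rewrite -[leLHS]real_normK ?num_real// -[leRHS]real_normK ?num_real//.
  by rewrite lerXn2r ?nnegrE// normr_sin_le.
have -> : (b / 2) ^+ 2 = b ^+ 2 / 4 by field.
by rewrite -(mulr_natr (sin _ ^+ 2)); lra.
Qed.

Lemma sin_second_order b : `|b| <= 1 -> `|sin b - b| <= b ^+ 2.
Proof.
have H (c : R) : 0 <= c -> c <= 1 -> `|sin c - c| <= c ^+ 2.
  move=> c0 c1; rewrite ler0_norm ?subr_le0 ?sin_le// opprB -subr_le0.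
  apply: (@le0_of_derive_le0 R (fun t => t - sin t - t ^+ 2)
    (fun t => 1 - cos t - 2 * t) 0 c) => //.
  - move=> t _; apply: is_deriveB.
    have := is_deriveX 2 (is_derive_id t (1 : R)).
    by move=> h; apply: (is_derive_ext h) => //=; rewrite /GRing.scale /= mulr1 expr1 mulrC.
  - move=> t /andP[t0 tc]; have := cos_second_order t.
    rewrite ler_norml => /andP[h _].
    have : t ^+ 2 <= t by rewrite expr2 ler_piMl//; lra.
    lra.
  - by rewrite sin0 expr0n /= !subr0.
have [b0|b0] := leP 0 b; first by rewrite (ger0_norm b0); exact: H.
rewrite ltr0_norm// => b1.
have := H (- b); rewrite sinN sqrrN (_ : - sin b - - b = - (sin b - b)); last by ring.
by rewrite normrN; apply => //; rewrite oppr_ge0 ltW.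
Qed.

(** For [z = a + i b] the coordinates of the error are at most [2 a^2 + b^2] and [a^2 + 3 b^2],
    hence the constant 4. *)
Lemma cexp_second_order z : normc z <= 2^-1 ->
  normc (cexp z - 1 - z) <= 4 * normc z ^+ 2.
Proof.
move=> z2; have az := le_trans (ler_Re_normc z) z2.
have bz := le_trans (ler_Im_normc z) z2.
rewrite (le_trans (ler_normc_ReIm _))// sqr_normc_ReIm.
rewrite !ReD !ImD !ReN !ImN Re_cexp Im_cexp /=.
move: (complex.Re z) (complex.Im z) az bz => a b az bz.
have e2 := expR_le2 az; have e0 := expR_gt0 a.
have h1 := expR_second_order az.
have h2 := cos_second_order b.
have h3 := @sin_second_order b (le_trans bz _).
have {}h3 : `|sin b - b| <= b ^+ 2 by apply: h3; lra.
have r1 : `|expR a * cos b - 1 - a| <= 2 * a ^+ 2 + b ^+ 2.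
  have -> : expR a * cos b - 1 - a = (expR a - 1 - a) + expR a * (cos b - 1) by ring.
  rewrite (le_trans (ler_normD _ _))// lerD// normrM (ger0_norm (ltW e0)).
  have -> : b ^+ 2 = 2 * (b ^+ 2 / 2) by field.
  by rewrite ler_pM// ltW.
have r2 : `|expR a * sin b - b| <= 2 * b ^+ 2 + (a ^+ 2 + b ^+ 2).
  have -> : expR a * sin b - b = expR a * (sin b - b) + (expR a - 1) * b by ring.
  rewrite (le_trans (ler_normD _ _))// lerD//.
    by rewrite normrM (ger0_norm (ltW e0)) ler_pM// ltW.
  have ea : `|expR a - 1| <= 2 * `|a|.
    have -> : expR a - 1 = (expR a - 1 - a) + a by ring.
    rewrite (le_trans (ler_normD _ _))// [leRHS]mulrDl !mul1r lerD//.
    rewrite (le_trans h1)// -real_normK ?num_real// expr2 mulrA.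
    by rewrite ler_piMl//; lra.
  rewrite normrM (le_trans (ler_wpM2r _ ea))//.
  rewrite -[a ^+ 2]real_normK ?num_real// -[b ^+ 2]real_normK ?num_real//.
  by have := sqr_ge0 (`|a| - `|b|); rewrite sqrrB -mulr_natr; lra.
rewrite oppr0 addr0; have := sqr_ge0 a; lra.
Qed.

End second_order_bounds.

(** * The approximate quadratic equation for the rescaled Herglotz transform *)

Section asymptotics.
Variable R : realType.
Variables (sigma x r : R) (h : R[i]).
Hypotheses (sigma0 : 0 < sigma) (sigma4 : sigma <= 4^-1) (x2 : -2 < x < 2).
Hypotheses (r_ge : 1 - sigma ^+ 2 <= r) (r_le : r <= 1).
Hypothesis Re_h : 0 < complex.Re h.
Hypothesis h_eq : r%:C * cis (- (sigma * x)) * (h + 1) =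
  (h - 1) * cexp ((sigma ^+ 2 / 2)%:C * h).

Let r0 : 0 <= r.
Proof.
apply: le_trans r_ge; rewrite subr_ge0 expr2.
by rewrite (le_trans (ler_pM (ltW sigma0) (ltW sigma0) sigma4 sigma4))//; lra.
Qed.

(* Taking moduli, [|h - 1|^2 e^(sigma^2 Re h) <= |h + 1|^2 = |h - 1|^2 + 4 Re h]. *)
Lemma normc_subr1_bound : sigma * normc (h - 1) <= 2.
Proof.
have := congr1 (@normc R) h_eq.
rewrite normcM [normc (r%:C * _)]normcM [normc (_ * cexp _)]normcM normc_cexp.
rewrite normc_real normc_cis mulr1 ReM /= mul0r subr0.
rewrite (ger0_norm r0) => E.
have : (normc (h - 1) * expR (sigma ^+ 2 / 2 * complex.Re h)) ^+ 2 <= normc (h + 1) ^+ 2.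
  rewrite -E lerXn2r ?nnegrE ?mulr_ge0 ?normc_ge0//.
  by rewrite ler_piMl ?normc_ge0.
rewrite exprMn [X in _ * X]expr2 -expRD.
have -> : sigma ^+ 2 / 2 * complex.Re h + sigma ^+ 2 / 2 * complex.Re h =
  sigma ^+ 2 * complex.Re h by field.
have -> : normc (h + 1) ^+ 2 = normc (h - 1) ^+ 2 + 4 * complex.Re h.
  by rewrite !sqr_normc_ReIm !ReD !ImD ReN ImN /=; ring.
move=> H.
have := expR_ge1Dx (sigma ^+ 2 * complex.Re h).
move=> /(ler_wpM2l (sqr_ge0 (normc (h - 1)))) /le_trans /(_ H).
rewrite mulrDr mulr1 lerD2l mulrA ler_pM2r// => {}H.
rewrite -(@ler_pXn2r _ 2) ?nnegrE ?mulr_ge0 ?normc_ge0 ?(ltW sigma0)//.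
by rewrite exprMn mulrC; lra.
Qed.

Let w := sigma%:C * h.
Let zeta := (sigma ^+ 2 / 2)%:C * h.

Let zetaE : zeta = (sigma / 2)%:C * w.
Proof. by rewrite /zeta /w mulrA -rmorphM; congr (_%:C * _); field. Qed.

Let wB : normc (w - sigma%:C) <= 2.
Proof.
have -> : w - sigma%:C = sigma%:C * (h - 1) by rewrite /w; ring.
by rewrite normcM normc_real ger0_norm ?(ltW sigma0)// normc_subr1_bound.
Qed.

Let sigma_norm : normc sigma%:C = sigma.
Proof. by rewrite normc_real ger0_norm ?(ltW sigma0). Qed.

Let w3 : normc w <= 2 + sigma.
Proof.
rewrite -[w](subrK sigma%:C) (le_trans (ler_normcD _ _))//.
by rewrite sigma_norm lerD2r.
Qed.

Let wD : normc (w + sigma%:C) <= 3.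
Proof.
rewrite (le_trans (ler_normcD _ _))// sigma_norm.
by have := w3; have := sigma4; lra.
Qed.

(** In [(w - sigma)(1 + zeta) - (1 + y)(w + sigma)], with [zeta = sigma w / 2] and
    [y = - i sigma x], the terms of order 0 cancel and those of order 1 are [sigma / 2] times the
    quadratic. Remainders of order [sigma^2] thus leave an error of order [sigma]. *)
Lemma scaled_quadratic_bound :
  normc (w ^+ 2 + 2 * (0 +i* x) * w - 4) <= 145 * sigma.
Proof.
have nx : normc (0 +i* x) <= 2.
  rewrite (le_trans (ler_normc_ReIm _))//= normr0 add0r ler_norml.
  by case/andP: x2 => h1 h2; apply/andP; split; exact: ltW.
have zB : normc zeta <= 3 / 2 * sigma.
  rewrite zetaE normcM normc_real ger0_norm ?divr_ge0 ?(ltW sigma0)//.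
  apply: (@le_trans _ _ (sigma / 2 * 3)); last by lra.
  rewrite ler_wpM2l ?divr_ge0 ?(ltW sigma0)//.
  by have := w3; have := sigma4; lra.
have z2 : normc zeta <= 2^-1 by have := sigma4; lra.
pose E1 := cexp zeta - 1 - zeta.
have E1B : normc E1 <= 9 * sigma ^+ 2.
  rewrite (le_trans (cexp_second_order z2))//.
  have : normc zeta ^+ 2 <= (3 / 2 * sigma) ^+ 2.
    by rewrite lerXn2r ?nnegrE ?normc_ge0 ?mulr_ge0 ?(ltW sigma0)//; lra.
  rewrite exprMn; lra.
pose y : R[i] := 0 +i* (- (sigma * x)).
have yE : y = - (sigma%:C * (0 +i* x)).
  by apply: complex_eqP; rewrite ?(ReN, ImN, ReM, ImM) /=; ring.
have yB : normc y <= 2 * sigma.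
  by rewrite yE normcN normcM sigma_norm mulrC ler_wpM2r ?(ltW sigma0).
have y2 : normc y <= 2^-1 by have := sigma4; lra.
have cisE : cis (- (sigma * x)) = cexp y.
  by rewrite /cexp /= expR0 mul1r.
pose E2 := r%:C * cis (- (sigma * x)) - (1 + y).
have E2B : normc E2 <= 17 * sigma ^+ 2.
  have -> : E2 = (r - 1)%:C * cexp y + (cexp y - 1 - y).
    by rewrite /E2 cisE rmorphB /=; ring.
  rewrite (le_trans (ler_normcD _ _))// normcM normc_real -cisE normc_cis mulr1 cisE.
  have := cexp_second_order y2.
  have : normc y ^+ 2 <= (2 * sigma) ^+ 2.
    by rewrite lerXn2r ?nnegrE ?normc_ge0 ?mulr_ge0 ?(ltW sigma0).
  have : `|r - 1| <= sigma ^+ 2.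
    by rewrite distrC ger0_norm ?subr_ge0//; have := r_ge; lra.
  rewrite exprMn; lra.
have Eq : r%:C * cis (- (sigma * x)) * (w + sigma%:C) = (w - sigma%:C) * cexp zeta.
  have -> : w + sigma%:C = sigma%:C * (h + 1) by rewrite /w; ring.
  have -> : w - sigma%:C = sigma%:C * (h - 1) by rewrite /w; ring.
  by rewrite mulrCA h_eq mulrA.
have sn0 : sigma%:C != 0 :> R[i] by rewrite eq_complex /= gt_eqF.
have -> : w ^+ 2 + 2 * (0 +i* x) * w - 4 =
   (2 / sigma%:C) * ((- (w - sigma%:C)) * E1 + E2 * (w + sigma%:C)) +
   sigma%:C * (w - 2 * (0 +i* x)).
  have -> : (- (w - sigma%:C)) * E1 + E2 * (w + sigma%:C) =
      (w - sigma%:C) * (1 + zeta) - (1 + y) * (w + sigma%:C).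
    by rewrite /E1 /E2 [in LHS]mulrBl Eq; ring.
  rewrite zetaE yE rmorphM /= fmorphV /= rmorph_nat.
  move: (0 +i* x) => X; field.
  by rewrite sn0.
rewrite (le_trans (ler_normcD _ _))//.
(* Here [69 = 2 * 9 + 17 * 3]; the total is then [145 = 2 * 69 + 7]. *)
have b1 : normc ((- (w - sigma%:C)) * E1 + E2 * (w + sigma%:C)) <= 69 * sigma ^+ 2.
  rewrite (le_trans (ler_normcD _ _))// !normcM normcN.
  have := ler_pM (normc_ge0 _) (normc_ge0 _) wB E1B.
  have := ler_pM (normc_ge0 _) (normc_ge0 _) E2B wD.
  lra.
have b2 : normc (w - 2 * (0 +i* x)) <= 7.
  rewrite (le_trans (ler_normcD _ _))// normcN [normc (2 * _)]normcM normc_nat.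
  by have := w3; have := sigma4; lra.
have -> : 145 * sigma = 2 / sigma * (69 * sigma ^+ 2) + sigma * 7.
  by field; rewrite gt_eqF.
apply: lerD.
  rewrite normcM; apply: ler_pM => //; rewrite ?normc_ge0//.
  by rewrite normcM normc_nat normcV sigma_norm.
by rewrite normcM sigma_norm ler_wpM2l// ltW.
Qed.

Lemma semicircle_bound : `|sigma * complex.Re h - Num.sqrt (4 - x ^+ 2)| <=
  145 / Num.sqrt (4 - x ^+ 2) * sigma.
Proof.
set q := Num.sqrt _.
have x4 : 0 < 4 - x ^+ 2.
  case/andP: x2 => h1 h2; have -> : 4 - x ^+ 2 = (2 - x) * (2 + x) by ring.
  by rewrite mulr_gt0//; lra.
have q0 : 0 < q by rewrite sqrtr_gt0.
have q2 : q ^+ 2 = 4 - x ^+ 2 by rewrite sqr_sqrtr// ltW.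
rewrite mulrAC ler_pdivlMr//.
rewrite (le_trans _ scaled_quadratic_bound)//.
pose y := 0 +i* x.
(* The real parts bound the factors below, the first by [|Re w - q|] and the second by [q] since
   [Re w > 0]; dividing by [q] gives the estimate. *)
have -> : w ^+ 2 + 2 * y * w - 4 = (w + y - q%:C) * (w + y + q%:C).
  have -> : (4 : R[i]) = q%:C ^+ 2 - y ^+ 2.
    move: q2; rewrite !expr2 => q2.
    apply: complex_eqP; rewrite ?(ReD, ImD, ReN, ImN, ReM, ImM, Re_nat, Im_nat) /=.
      lra.
    ring.
  ring.
rewrite normcM; apply: ler_pM => //; first exact: ltW.
  rewrite (le_trans _ (ler_Re_normc _))// !ReD ReN ReM /= mul0r !subr0 addr0//.
rewrite (le_trans _ (ler_Re_normc _))// !ReD ReM /= mul0r subr0 addr0.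
by rewrite (le_trans _ (ler_norm _))// lerDr mulr_ge0// ltW.
Qed.

End asymptotics.

(** * Boundary values of the Poisson integral *)

Section density_change_of_variables.
Local Open Scope ereal_scope.
Context d (T : measurableType d) (R : realType).
Variables (m nu : {measure set T -> \bar R}) (g : T -> R).
Hypotheses (mg : measurable_fun setT g) (g0 : forall x, (0 <= g x)%R).
Hypothesis mE : forall A, measurable A -> m A = \int[nu]_(x in A) (g x)%:E.

Import HBNNSimple.

Let integral_density_nnsfun (h : {nnsfun T >-> R}) :
  \int[m]_x (h x)%:E = \int[nu]_x ((h x)%:E * (g x)%:E).
Proof.
have mgE : measurable_fun setT (fun x => (g x)%:E) by exact/measurable_EFinP.
rewrite integralT_nnsfun sintegralE.
have hE x : (h x)%:E * (g x)%:E =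
    \sum_(r \in range h) ((r * \1_(h @^-1` [set r]) x)%:E * (g x)%:E).
  rewrite {1}(fimfunE h x) -fsumEFin// ge0_mule_fsuml// => r.
  by rewrite EFinM nnfun_muleindic_ge0.
under eq_integral do rewrite hE.
rewrite ge0_integral_fsum//; last 2 first.
- move=> r; apply: emeasurable_funM => //.
  by apply/measurable_EFinP; exact: measurableT_comp.
- move=> r x _; apply: mule_ge0; last by rewrite lee_fin.
  by rewrite EFinM nnfun_muleindic_ge0.
apply: eq_fsbigr => r /[!inE] -[x _ hx].
have r0 : (0 <= r)%R by rewrite -hx.
have mh : measurable (h @^-1` [set r]) by exact: measurable_sfunP.
rewrite mE// [in LHS]integral_mkcond -ge0_integralZl//; last 2 first.
- by apply/(measurable_restrictT _ mh)/measurable_funTS.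
- by move=> y _; rewrite patchE; case: ifP => // _; rewrite lee_fin.
apply: eq_integral => y _; rewrite patchE indicE.
by case: ifP => _; rewrite ?mulr1 ?mulr0 ?mule0 ?mul0e.
Qed.

(** Simple functions first, then monotone approximation on both sides. It serves twice below: for
    [mu] against [circle_length], and for Lebesgue measure restricted to the arc. *)
Lemma ge0_integral_density (f : T -> \bar R) : measurable_fun setT f ->
  (forall x, 0 <= f x) -> \int[m]_x f x = \int[nu]_x (f x * (g x)%:E).
Proof.
move=> mf f0; pose f_ := nnsfun_approx measurableT mf.
have mgE : measurable_fun setT (fun x => (g x)%:E) by exact/measurable_EFinP.
transitivity (limn (fun n => \int[m]_x (f_ n x)%:E)).
  rewrite -monotone_convergence//=.
  - by apply: eq_integral => x _; apply/esym/cvg_lim => //=; exact: cvg_nnsfun_approx.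
  - by move=> n; exact/measurable_EFinP.
  - by move=> n x _; rewrite lee_fin.
  - by move=> x _ i j ij; rewrite lee_fin; exact/lefP/nd_nnsfun_approx.
under eq_fun do rewrite integral_density_nnsfun.
rewrite -monotone_convergence//=.
- apply: eq_integral => x _; apply/cvg_lim => //.
  apply: cvgeZr => //; exact: cvg_nnsfun_approx.
- by move=> n; apply: emeasurable_funM => //; exact/measurable_EFinP.
- by move=> n x _; rewrite mule_ge0 ?lee_fin.
- move=> x _ i j ij; rewrite lee_wpmul2r ?lee_fin//.
  exact/lefP/nd_nnsfun_approx.
Qed.

End density_change_of_variables.

(** * The Poisson kernel in the angle variable *)

Section poisson_kernel.
Variable R : realType.
Local Notation lebesgue := (@lebesgue_measure R).
Implicit Types (r y t delta : R).

Definition poisson_kernel r y := (1 - r ^+ 2) / (1 - 2 * r * cos y + r ^+ 2).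

Lemma poisson_denominator_gt0 r y : 0 <= r < 1 -> 0 < 1 - 2 * r * cos y + r ^+ 2.
Proof.
move=> /andP[r0 r1].
have -> : 1 - 2 * r * cos y + r ^+ 2 = (1 - r) ^+ 2 + 2 * (r * (1 - cos y)) by ring.
rewrite ltr_pwDl ?exprn_gt0 ?subr_gt0//.
by rewrite !mulr_ge0// subr_ge0 cos_le1.
Qed.

Lemma poisson_kernel_ge0 r y : 0 <= r < 1 -> 0 <= poisson_kernel r y.
Proof.
move=> r01; rewrite divr_ge0// ?(ltW (poisson_denominator_gt0 _ r01))//.
by case/andP: r01 => r0 r1; rewrite subr_ge0 expr_le1// ltW.
Qed.

Lemma continuous_poisson_kernel r : 0 <= r < 1 -> continuous (poisson_kernel r).
Proof.
move=> r01 y; apply: cvgM; first exact: cvg_cst.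
apply: cvgV; first by rewrite gt_eqF// poisson_denominator_gt0.
apply: cvgD; last exact: cvg_cst.
apply: cvgB; first exact: cvg_cst.
by apply: cvgM; [exact: cvg_cst|exact: continuous_cos].
Qed.

(** The denominator is [(1 - r)^2 + 2 r (1 - cos y)], and [r >= 1/2] makes [2 r >= 1], so it
    dominates [1 - cos delta]. *)
Lemma poisson_kernel_outer r y delta : 2^-1 <= r < 1 -> cos delta < 1 ->
  cos y <= cos delta -> poisson_kernel r y <= 2 * (1 - r) / (1 - cos delta).
Proof.
move=> /andP[r2 r1] d1 yd.
have c0 : 0 < 1 - cos delta by rewrite subr_gt0.
have r0 : 0 <= r by lra.
have D0 : 0 < 1 - 2 * r * cos y + r ^+ 2 by rewrite poisson_denominator_gt0// r0.
have cD : 1 - cos delta <= 1 - 2 * r * cos y + r ^+ 2.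
  have -> : 1 - 2 * r * cos y + r ^+ 2 = (1 - r) ^+ 2 + 2 * r * (1 - cos y) by ring.
  have h1 := sqr_ge0 (1 - r).
  have h2 : 1 * (1 - cos delta) <= 2 * r * (1 - cos y) by apply: ler_pM => //; lra.
  lra.
apply: ler_pM.
- by rewrite subr_ge0 expr_le1// ltW.
- by rewrite invr_ge0 ltW.
- have -> : 1 - r ^+ 2 = (1 + r) * (1 - r) by ring.
  by rewrite ler_wpM2r//; lra.
- by rewrite lef_pV2.
Qed.

(* With [k = (1+r)/(1-r)], half-angle formulas turn the Poisson kernel into
   [k / (cos^2 (y/2) + k^2 sin^2 (y/2))], the derivative of [2 atan (k tan (y/2))]. *)
Definition poisson_primitive r y := 2 * atan ((1 + r) / (1 - r) * tan (y / 2)).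

Lemma is_derive_poisson_primitive r y : 0 <= r < 1 -> - pi < y < pi ->
  is_derive y 1 (poisson_primitive r) (poisson_kernel r y).
Proof.
move=> /andP[r0 r1] /andP[y1 y2].
have c0 : 0 < cos (y / 2) by apply: cos_gt0_pihalf; apply/andP; split; lra.
have dh : is_derive y 1 (fun t => t / 2) (2^-1 : R).
  apply: (is_derive_ext (is_deriveZ (2^-1 : R) (is_derive_id y (1 : R)))).
    by move=> t; rewrite /GRing.scale /= mulrC.
  by rewrite /GRing.scale /= mulr1.
have dt := @is_derive1_comp R (@tan R) (fun t => t / 2) y _ _
  (@is_derive_tan R (y / 2) (lt0r_neq0 c0)) dh.
have dk := is_deriveZ ((1 + r) / (1 - r)) dt.
have da := @is_derive1_comp R (@atan R) _ y _ _
  (is_derive1_atan ((1 + r) / (1 - r) * tan (y / 2))) dk.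
have db := is_deriveZ (2 : R) da.
apply: (@is_derive_eq _ _ _ _ _ _ _ _ db).
have cosy : cos y = cos (y / 2) ^+ 2 - sin (y / 2) ^+ 2.
  by rewrite {1}(splitr y) cosD !expr2.
have r1n : 1 - r != 0 by rewrite subr_eq0 gt_eqF.
have D0 := poisson_denominator_gt0 y (introT andP (conj r0 r1)).
rewrite /GRing.scale /= /poisson_kernel /tan.
move: D0; rewrite cosy.
have sc : sin (y / 2) ^+ 2 = 1 - cos (y / 2) ^+ 2 by rewrite sin2cos2.
move: (sin (y / 2)) (cos (y / 2)) c0 sc => s c c0 sc D0.
have cn : c != 0 by rewrite gt_eqF.
have s2 : c ^+ 2 = 1 - s ^+ 2 by rewrite sc; ring.
have K : (1 - r) ^+ 2 * c ^+ 2 + (1 + r) ^+ 2 * s ^+ 2 =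
    1 - 2 * r * (c ^+ 2 - s ^+ 2) + r ^+ 2 by rewrite sc; ring.
rewrite -K.
have K0 : (1 - r) ^+ 2 * c ^+ 2 + (1 + r) ^+ 2 * s ^+ 2 != 0 by rewrite K gt_eqF.
field.
by rewrite !exprMn K0 cn r1n.
Qed.

(** With [delta < pi] the segment avoids the poles of [tan (y / 2)], and the odd primitive gives the
    mass exactly. The full mass [2 pi] reappears as the limit, [atan] tending to [pi / 2]. *)
Lemma poisson_inner_mass r theta delta : 0 <= r < 1 -> 0 < delta < pi ->
  \int[lebesgue]_(t in `[theta - delta, theta + delta]) poisson_kernel r (t - theta) =
  4 * atan ((1 + r) / (1 - r) * tan (delta / 2)).
Proof.
move=> r01 /andP[d0 dpi].
have ds (f : R -> R) y l : is_derive (y - theta) 1 f l ->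
    is_derive y 1 (fun t => f (t - theta)) l.
  move=> fl; have := @is_derive1_comp R f (fun t => t - theta) y l 1 fl.
  by rewrite mulr1; apply; apply: is_derive_eq; rewrite subr0.
have dF y : theta - delta <= y <= theta + delta ->
    is_derive y 1 (fun t => poisson_primitive r (t - theta)) (poisson_kernel r (y - theta)).
  move=> /andP[y1 y2]; apply: ds; apply: is_derive_poisson_primitive => //.
  by apply/andP; split; lra.
have ab : theta - delta < theta + delta by lra.
have cF y : theta - delta <= y <= theta + delta ->
    {for y, continuous (fun t => poisson_primitive r (t - theta))}.
  move=> /dF[dy _]; apply: differentiable_continuous.
  exact/derivable1_diffP.
have E := @continuous_FTC2 R (fun t => poisson_kernel r (t - theta))
  (fun t => poisson_primitive r (t - theta)) _ _ ab.
rewrite /Rintegral E.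
- rewrite /= /poisson_primitive.
  have -> : theta + delta - theta = delta by ring.
  have -> : theta - delta - theta = - delta by ring.
  by rewrite mulNr tanN mulrN atanN; ring.
- apply: continuous_subspaceT => y.
  apply: (@continuous_comp _ _ _ (fun t => t - theta) (poisson_kernel r)).
    by apply: cvgB; [exact: cvg_id|exact: cvg_cst].
  exact: continuous_poisson_kernel.
- split.
  + move=> y; rewrite in_itv/= => /andP[/ltW y1 /ltW y2].
    by have [] := dF y (introT andP (conj y1 y2)).
  + by apply: cvg_at_right_filter; apply: cF; rewrite lexx ltW.
  + by apply: cvg_at_left_filter; apply: cF; rewrite lexx ltW.
- move=> y; rewrite in_itv/= => /andP[/ltW y1 /ltW y2].
  by have [_] := dF y (introT andP (conj y1 y2)); rewrite derive1E.
Qed.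

Lemma poisson_inner_mass_near (delta eps : R) : 0 < delta < pi -> 0 < eps ->
  exists2 r0, 0 <= r0 < 1 & forall r, r0 < r < 1 ->
    2 * pi - eps <= 4 * atan ((1 + r) / (1 - r) * tan (delta / 2)) <= 2 * pi.
Proof.
move=> /andP[d0 dpi] eps0.
have t0 : 0 < tan (delta / 2).
  rewrite /tan divr_gt0//.
    by apply: sin_gt0_pi; apply/andP; split; lra.
  by apply: cos_gt0_pihalf; apply/andP; split; lra.
have pi0 := pi_gt0 R.
pose e := Num.min (eps / 4) (pi / 2).
have e0 : 0 < e by rewrite lt_min !divr_gt0.
have e1 : e <= eps / 4 by rewrite ge_min lexx.
have e2 : e <= pi / 2 by rewrite ge_min lexx orbT.
(* Once [(1 + r) / (1 - r) >= Y], the arctangent is at least [pi / 2 - e], and [4 e <= eps]; the cap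
   [e <= pi / 2] keeps [pi / 2 - e] where [atan] inverts [tan]. *)
pose Y := tan (pi / 2 - e) / tan (delta / 2).
exists (Num.max 0 (1 - (`|Y| + 1)^-1)).
  rewrite le_max lexx /= gt_max ltr01 /= ltrBlDr ltrDl invr_gt0.
  by rewrite ltr_wpDl.
move=> r; rewrite gt_max => /andP[/andP[r0 rY] r1].
have k0 : 0 < 1 - r by rewrite subr_gt0.
have Yk : Y <= (1 + r) / (1 - r).
  have h : `|Y| + 1 <= (1 - r)^-1.
    have Y0 : 0 < `|Y| + 1 by rewrite ltr_wpDl.
    rewrite -[leLHS]invrK lef_pV2 ?posrE ?invr_gt0//.
    by rewrite lerBlDl -lerBlDr ltW.
  have Y1 := ler_norm Y.
  apply: (@le_trans _ _ (1 - r)^-1); first by lra.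
  by rewrite ler_peMl ?invr_ge0 ?(ltW k0)//; lra.
apply/andP; split; last by have := atan_ltpi2 ((1 + r) / (1 - r) * tan (delta / 2)); lra.
have : atan (tan (pi / 2 - e)) <= atan ((1 + r) / (1 - r) * tan (delta / 2)).
  by apply: le_atan; rewrite -ler_pdivrMr.
rewrite tanK; first by lra.
by rewrite in_itv/=; apply/andP; split; lra.
Qed.

End poisson_kernel.

(** * Integrals against the measure as integrals over the arc *)

Section circle_density.
Local Open Scope ereal_scope.
Variable R : realType.
Variables (mu : probability (borel_circle R) R) (g : circle R -> R).
Hypothesis mu_g : continuous_density mu g.
Local Notation lebesgue := (@lebesgue_measure R).

Lemma ge0_integral_circle_density (F : borel_circle R -> \bar R) :
  measurable_fun setT F -> (forall u, 0 <= F u) ->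
  \int[mu]_u F u =
  \int[lebesgue]_(t in @Defs.arc R) (F (expi t) * (g (expi t))%:E).
Proof.
move=> mF F0; have [cg g0 muE] := mu_g.
have mg : measurable_fun setT (g : borel_circle R -> R).
  exact: circle_continuous_measurable.
have mFg : measurable_fun setT (fun u : borel_circle R => F u * (g u)%:E).
  by apply: emeasurable_funM => //; exact/measurable_EFinP.
rewrite (@ge0_integral_density _ _ _ mu (@circle_length R) g mg g0 muE F mF F0).
rewrite (@ge0_integral_pushforward _ _ _ _ _ _ (@measurable_expi R)
  (mrestr lebesgue (@measurable_arc R)) setT)//; last first.
  by move=> u _; rewrite mule_ge0// lee_fin.
rewrite preimage_setT.
(* Restricted Lebesgue measure is itself a measure with density, namely the indicator of the arc. *)
rewrite (@ge0_integral_density _ _ _ (mrestr lebesgue (@measurable_arc R))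
  lebesgue (\1_(@Defs.arc R))); last 5 first.
- by apply: measurable_indic; exact: measurable_arc.
- by move=> t; rewrite indicE ler0n.
- move=> A mA; rewrite integral_indic//; last exact: measurable_arc.
  by rewrite /mrestr setIC.
- exact: (measurableT_comp mFg (@measurable_expi R)).
- by move=> t; rewrite mule_ge0// lee_fin.
rewrite [RHS]integral_mkcond; apply: eq_integral => t _.
by rewrite patchE indicE; case: ifP => _; rewrite ?mule1 ?mule0.
Qed.

End circle_density.

(** * Radial convergence of the Poisson integral to the density *)

Section poisson_integral.
Variable R : realType.
Local Notation lebesgue := (@lebesgue_measure R).

(** [2 / (1 - v r) - 1] is the Herglotz kernel [(1 + v r) / (1 - v r)], with real part
    [(1 - r^2) / |1 - v r|^2]. *)
Lemma Re_herglotz_kernel (v : R[i]) (r : R) : normc v = 1 -> 0 <= r < 1 ->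
  complex.Re (2 * (1 - v * r%:C)^-1 - 1) =
  (1 - r ^+ 2) / (1 - 2 * r * complex.Re v + r ^+ 2).
Proof.
move=> v1 /andP[r0 r1].
have : complex.Re v ^+ 2 + complex.Im v ^+ 2 = 1.
  by rewrite -sqr_normc_ReIm v1 expr1n.
have := ler_Re_normc v; rewrite v1 ler_norml.
case: v {v1} => a b /= /andP[a1 a2] ab.
have D0 : 0 < 1 - 2 * r * a + r ^+ 2.
  have -> : 1 - 2 * r * a + r ^+ 2 = (1 - r) ^+ 2 + 2 * (r * (1 - a)) by ring.
  by rewrite ltr_pwDl ?exprn_gt0 ?subr_gt0// !mulr_ge0// subr_ge0.
rewrite !(mulr0, addr0, subr0, oppr0, mul0r, add0r).
have -> : (1 - a * r) ^+ 2 + (- (b * r)) ^+ 2 = 1 - 2 * r * a + r ^+ 2.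
  transitivity (1 - 2 * r * a + r ^+ 2 * (a ^+ 2 + b ^+ 2)); first by ring.
  by rewrite ab mulr1.
by field; rewrite gt_eqF.
Qed.

Variables (mu : probability (borel_circle R) R).

Lemma Re_herglotz (om : R[i]) (r : R) : normc om = 1 -> 0 <= r < 1 ->
  complex.Re (2 * Qmoment mu om 0 r - 1) =
  \int[mu]_u ((1 - r ^+ 2) / (1 - 2 * r * complex.Re (cval u * om) + r ^+ 2)).
Proof.
move=> om1 r01; have /andP[r0 r1] := r01.
have rr : `|r| < 1 by rewrite ger0_norm.
have iq := cintegrable_qterm om1 0 rr.
have := CintegralD mu (cintegrableZ 2 iq) (cintegrable_cst (-1)).
rewrite (CintegralZ mu 2 iq) Cintegral_cst => <-.
rewrite /Cintegral /=; apply: eq_Rintegral => u _.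
rewrite /qterm expr0 mul1r expr1 /resolvent Re_herglotz_kernel//.
by rewrite normcM normc_cval om1 mulr1.
Qed.

(** The modulus of [1 - v r] lies between [1 - r] and [1 + r]. The lower bound makes [Re h] strictly
    positive, the upper one gives integrability. *)
Lemma poisson_integrand_bound (v : R[i]) (r : R) : normc v = 1 -> 0 <= r < 1 ->
  (1 - r) / 2 <= (1 - r ^+ 2) / (1 - 2 * r * complex.Re v + r ^+ 2) <= 2 / (1 - r).
Proof.
move=> v1 /andP[r0 r1].
have := ler_Re_normc v; rewrite v1 ler_norml => /andP[]; move: (complex.Re v) => a a1 a2.
have h1 : (1 - r) ^+ 2 <= 1 - 2 * r * a + r ^+ 2.
  have : 0 <= r * (1 - a) by rewrite mulr_ge0// subr_ge0.
  by rewrite expr2; lra.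
have r1' : 0 < 1 - r by rewrite subr_gt0.
have h2 : 1 - 2 * r * a + r ^+ 2 <= (1 + r) ^+ 2.
  have : 0 <= r * (1 + a) by rewrite mulr_ge0//; lra.
  by rewrite !expr2; lra.
have D0 : 0 < 1 - 2 * r * a + r ^+ 2 by rewrite (lt_le_trans _ h1)// exprn_gt0.
apply/andP; split.
- rewrite ler_pdivlMr// (le_trans (ler_wpM2l _ h2))//; first by lra.
  have -> : (1 - r) / 2 * (1 + r) ^+ 2 = (1 - r ^+ 2) * ((1 + r) / 2) by field.
  rewrite ler_piMr ?subr_ge0 ?expr_le1 ?(ltW r1)//; lra.
- rewrite ler_pdivrMr// (le_trans _ (ler_wpM2l _ h1))//; last first.
    by rewrite divr_ge0// ltW.
  have -> : 2 / (1 - r) * (1 - r) ^+ 2 = 2 * (1 - r) by field; rewrite gt_eqF.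
  have -> : 1 - r ^+ 2 = (1 + r) * (1 - r) by ring.
  by rewrite ler_wpM2r ?(ltW r1')//; lra.
Qed.

Let poisson (om : R[i]) (r : R) (u : borel_circle R) :=
  (1 - r ^+ 2) / (1 - 2 * r * complex.Re (cval u * om) + r ^+ 2).

Let measurable_poisson om r : normc om = 1 -> 0 <= r < 1 ->
  measurable_fun setT (poisson om r).
Proof.
move=> om1 r01.
have -> : poisson om r = fun u => complex.Re (2 * qterm om 0 r u + (-1)).
  apply/funext => u; rewrite /qterm expr0 mul1r expr1 /resolvent.
  by rewrite Re_herglotz_kernel// normcM normc_cval om1 mulr1.
have mq := cmeasurable_qterm om 0 r.
by have [] := cmeasurableD (cmeasurableM (cmeasurable_cst 2) mq) (cmeasurable_cst (-1)).
Qed.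

Lemma Re_herglotz_gt0 (om : R[i]) (r : R) : normc om = 1 -> 0 <= r < 1 ->
  0 < complex.Re (2 * Qmoment mu om 0 r - 1).
Proof.
move=> om1 r01; rewrite Re_herglotz// -/(poisson om r).
have b u := @poisson_integrand_bound (cval u * om) r
  (etrans (normcM _ _) (etrans (congr1 (fun z => z * _) (normc_cval u))
    (etrans (mul1r _) om1))) r01.
have /andP[r0 r1] := r01.
have c0 : 0 < (1 - r) / 2 by rewrite divr_gt0// subr_gt0.
apply: (lt_le_trans c0).
rewrite -[leLHS](Rintegral_probability_cst mu); apply: le_Rintegral => //.
- by apply: (@bounded_integrable _ mu _ `|(1 - r) / 2|) => //; exact: measurable_cst.
- apply: (@bounded_integrable _ mu _ (2 / (1 - r))); first exact: measurable_poisson.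
  move=> u; have /andP[b1 b2] := b u.
  by rewrite ger0_norm// (le_trans _ b1)// ltW.
- by move=> u _; have /andP[] := b u.
Qed.

Variable g : circle R -> R.
Hypothesis mu_g : continuous_density mu g.

Lemma Rintegral_circle_density (F : borel_circle R -> R) :
  measurable_fun setT F -> (forall u, 0 <= F u) ->
  \int[mu]_u F u = \int[lebesgue]_(t in @Defs.arc R) (F (expi t) * g (expi t)).
Proof.
move=> mF F0; rewrite /Rintegral (ge0_integral_circle_density mu_g)//.
exact/measurable_EFinP.
Qed.

(** Distances are taken on the line, so [|t - theta|] may exceed [pi]; the cosine then sees
    [2 pi - |t - theta|], which stays above [delta] because [theta] keeps away from the ends of the
    arc. *)
Lemma cos_outer (theta delta t : R) : 0 < delta -> `|theta| + 2 * delta <= pi ->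
  - pi <= t < pi -> delta < `|t - theta| -> cos (t - theta) <= cos delta.
Proof.
move=> d0 td /andP[t1 t2] dt.
have a1 := ler_norm theta; have a2 := ler_norm (- theta); rewrite normrN in a2.
have yB : `|t - theta| <= 2 * pi - delta.
  by rewrite ler_norml; apply/andP; split; lra.
rewrite -(cos_norm (t - theta)); move: (`|t - theta|) dt yB => y dt yB.
have mono (c : R) : delta <= c -> c <= pi -> cos c <= cos delta.
  move=> dc cpi; have [->//|dcn] := eqVneq delta c.
  rewrite ltW// ltr_cos ?in_itv/=; first by rewrite lt_neqAle dcn.
  - by apply/andP; split; lra.
  - by apply/andP; split; lra.
have [ypi|piy] := leP y pi; first by apply: mono => //; exact: ltW.
have -> : cos y = cos (2 * pi - y).
  have -> : 2 * pi - y = - y + pi *+ 2 by rewrite -mulr_natl; ring.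
  by rewrite cosD2pi cosN.
by apply: mono; lra.
Qed.

Lemma continuous_integrable_itv (a b : R) (D : set (measurableTypeR R)) (f : R -> R) :
  measurable D -> D `<=` `[a, b]%classic -> continuous f ->
  lebesgue.-integrable D (EFin \o f).
Proof.
move=> mD DS cf.
have mS : measurable (`[a, b]%classic : set (measurableTypeR R)) by exact: measurable_itv.
apply: (integrableS mS mD DS).
apply: continuous_compact_integrable; first exact: segment_compact.
exact: continuous_subspaceT.
Qed.

(** [X] and [Y] are the inner and outer integrals, [K] is the inner mass times the density at
    [theta], [E] the oscillation of the density, and [S] the limit; three errors of [e / 3] add
    up. *)
Let normr_sandwich (X Y K E S e : R) : K - E <= X -> X <= K + E ->
  0 <= Y -> Y <= e / 3 -> E <= e / 3 -> K <= S -> S - e / 3 <= K ->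
  `|X + Y - S| <= e.
Proof. by move=> *; rewrite ler_norml; apply/andP; split; lra. Qed.

Lemma poisson_limit (theta eps : R) : - pi < theta < pi -> 0 < eps ->
  exists2 r0, 0 <= r0 < 1 & forall r, r0 < r < 1 ->
    `|complex.Re (2 * Qmoment mu (cis (- theta)) 0 r - 1) -
      2 * pi * g (expi theta)| <= eps.
Proof.
move=> /andP[th1 th2] eps0; have [cg g0 _] := mu_g.
have pi0 := pi_gt0 R.
pose G t := g (expi t).
have cG : continuous G.
  by move=> t; exact: (continuous_comp (@continuous_expi R t) (cg (expi t))).
have thn : `|theta| < pi by rewrite ltr_norml th1.
have g00 := g0 (expi theta).
(* The inner mass is at most [2 pi], so an oscillation of [e1] costs at most [eps / 3]. *)
pose e1 := eps / (6 * pi).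
have e10 : 0 < e1 by rewrite divr_gt0// mulr_gt0.
have [d1 d10 Gd1] : exists2 d1, 0 < d1 & forall t, `|t - theta| < d1 -> `|G t - G theta| <= e1.
  have /cvgrPdist_le/(_ _ e10) := cG theta.
  move=> /nbhs_ballP[d1 /= d10 H]; exists d1 => // t td.
  by rewrite distrC; apply: H; rewrite /ball /= distrC.
(* The second bound keeps the window inside the arc and gives the hypothesis of [cos_outer]. *)
pose delta := Num.min (d1 / 2) ((pi - `|theta|) / 2).
have d0 : 0 < delta by rewrite lt_min !divr_gt0// subr_gt0.
have dd1 : delta <= d1 / 2 by rewrite ge_min lexx.
have dth : delta <= (pi - `|theta|) / 2 by rewrite ge_min lexx orbT.
have a0 := normr_ge0 theta.
have a1 := ler_norm theta; have a2 := ler_norm (- theta); rewrite normrN in a2.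
have dpi : 0 < delta < pi by apply/andP; split => //; lra.
have cd1 : cos delta < 1.
  rewrite -(@cos0 R) ltr_cos ?in_itv/= ?lexx ?(ltW pi0)//.
  by case/andP: dpi => _ /ltW ->; rewrite ltW.
have c0 : 0 < 1 - cos delta by rewrite subr_gt0.
(* The missing inner mass is weighted by [G theta]; the added 1 covers a density vanishing at
   [theta]. *)
pose e2 := eps / (3 * (G theta + 1)).
have e20 : 0 < e2 by rewrite divr_gt0// mulr_gt0// ltr_wpDl.
have [r0 /andP[r00 r01] Hr] := poisson_inner_mass_near dpi e20.
(* Chosen so that [1 - r < e3] makes the outer kernel bound at most [eps / 3]. *)
pose e3 := eps * (1 - cos delta) / 6.
have e30 : 0 < e3 by rewrite divr_gt0// mulr_gt0.
exists (Num.max r0 (Num.max 2^-1 (1 - e3))).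
  rewrite !le_max r00 /= !gt_max r01 /= invf_lt1 ?ltr1n//=.
  by rewrite ltrBlDr ltrDl.
move=> r; rewrite !gt_max => /andP[/andP[rr0 /andP[r2 re3]] r1].
have rI : 0 <= r < 1 by rewrite r1 andbT (le_trans _ (ltW r2))// invr_ge0.
have rI2 : 2^-1 <= r < 1 by rewrite r1 (ltW r2).
have om1 := normc_cis (- theta).
have := Hr r; rewrite rr0 r1 => /(_ isT); rewrite -(@poisson_inner_mass R r theta)// => HJ.
set J := Rintegral _ _ _ in HJ.
pose P t := poisson_kernel r (t - theta).
have cP : continuous P.
  move=> t; apply: (@continuous_comp _ _ _ (fun t => t - theta) (poisson_kernel r)).
    by apply: cvgB; [exact: cvg_id|exact: cvg_cst].
  exact: continuous_poisson_kernel.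
have P0 t : 0 <= P t by exact: poisson_kernel_ge0.
have PE t : poisson (cis (- theta)) r (expi t) = P t.
  rewrite /poisson /P /poisson_kernel; congr (_ / (_ - _ * _ + _)).
  by rewrite ReM /= cosN sinN mulrN opprK cosB.
rewrite Re_herglotz// -/(poisson (cis (- theta)) r).
rewrite Rintegral_circle_density; last 2 first.
- exact: measurable_poisson.
- move=> u; apply: divr_ge0; first by case/andP: rI => h1 h2; rewrite subr_ge0 expr_le1// ltW.
  have v1 : normc (cval u * cis (- theta)) = 1 by rewrite normcM normc_cval om1 mulr1.
  have := ler_Re_normc (cval u * cis (- theta)); rewrite v1 ler_norml => /andP[_].
  move: (complex.Re _) => a aa; have /andP[rge0 _] := rI.
  have -> : 1 - 2 * r * a + r ^+ 2 = (1 - r) ^+ 2 + 2 * (r * (1 - a)) by ring.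
  by rewrite addr_ge0 ?sqr_ge0// !mulr_ge0// subr_ge0.
have -> : \int[lebesgue]_(t in @Defs.arc R)
    (poisson (cis (- theta)) r (expi t) * g (expi t)) =
    \int[lebesgue]_(t in @Defs.arc R) (P t * G t).
  by apply: eq_Rintegral => t _; rewrite -PE.
have ciS D f := @continuous_integrable_itv (- pi) pi D f.
have cPG : continuous (fun t => P t * G t).
  by move=> t; apply: cvgM; [exact: cP|exact: cG].
pose I : set (measurableTypeR R) := `[theta - delta, theta + delta]%classic.
pose O : set (measurableTypeR R) := @Defs.arc R `\` I.
have mI : measurable I by exact: measurable_itv.
have mO : measurable O by apply: measurableD => //; exact: measurable_arc.
have IA : I `<=` @Defs.arc R.
  move=> t; rewrite /I /Defs.arc /= !in_itv/= => /andP[t1 t2].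
  by apply/andP; split; lra.
have AS : @Defs.arc R `<=` `[- pi, pi]%classic.
  by move=> t; rewrite /Defs.arc /= !in_itv/= => /andP[-> /ltW ->].
have IS := subset_trans IA AS.
have OA : O `<=` @Defs.arc R by move=> t [].
have OS := subset_trans OA AS.
have AIO : @Defs.arc R = I `|` O.
  by rewrite /O setDUK.
have dIO : [disjoint I & O].
  by apply/disj_setPS => t [It [_ /(_ It)]].
have mA := @measurable_arc R.
rewrite {1}AIO Rintegral_setU//; last by rewrite -AIO; exact: ciS.
have G1 : \int[lebesgue]_(t in @Defs.arc R) G t = 1.
  have := @Rintegral_circle_density (cst 1) (measurable_cst _) (fun=> ler01).
  rewrite (Rintegral_probability_cst mu 1) => ->.
  by apply: eq_Rintegral => t _; rewrite mul1r.
have inner : G theta * J - e1 * J <= \int[lebesgue]_(t in I) (P t * G t) <=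
    G theta * J + e1 * J.
  have iP := ciS I P mI IS cP.
  have cPc (c : R) : continuous (fun t => c * P t).
    by move=> t; apply: cvgM; [exact: cvg_cst|exact: cP].
  have GI t : I t -> G theta - e1 <= G t <= G theta + e1.
    rewrite /I /= in_itv/= => /andP[t1 t2].
    have : `|G t - G theta| <= e1.
      by apply: Gd1; rewrite ltr_norml; apply/andP; split; lra.
    by rewrite ler_norml => /andP[h1 h2]; apply/andP; split; lra.
  rewrite -mulrBl -mulrDl -!RintegralZl//.
  apply/andP; split; apply: le_Rintegral => //; do ?exact: ciS.
  - by move=> t /GI/andP[h _]; rewrite [leRHS]mulrC; exact: ler_wpM2r (P0 t) _ _ h.
  - by move=> t /GI/andP[_ h]; rewrite [leLHS]mulrC; exact: ler_wpM2r (P0 t) _ _ h.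
have e3E : 2 * (1 - r) / (1 - cos delta) <= eps / 3.
  by rewrite ler_pdivrMr//; rewrite /e3 in re3; lra.
have outer : 0 <= \int[lebesgue]_(t in O) (P t * G t) <= eps / 3.
  apply/andP; split; first by apply: Rintegral_ge0 => t _; apply: mulr_ge0; [exact: P0|exact: g0].
  have ceG : continuous (fun t => eps / 3 * G t).
    by move=> t; apply: cvgM; [exact: cvg_cst|exact: cG].
  apply: (@le_trans _ _ (\int[lebesgue]_(t in O) (eps / 3 * G t))).
    apply: le_Rintegral => //; do ?exact: ciS.
    move=> t [At nIt]; apply: ler_wpM2r; first exact: g0.
    apply: le_trans e3E; apply: poisson_kernel_outer => //.
    apply: cos_outer => //; first by lra.
    move: nIt; rewrite /I /= in_itv/= => /negP; apply: contraNT; rewrite -leNgt.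
    by rewrite ler_norml => /andP[h1 h2]; apply/andP; split; lra.
  (* Adding the inner part completes the integral over the arc, which equals [eps / 3] since the
     density has total mass 1. *)
  have : \int[lebesgue]_(t in O) (eps / 3 * G t) <=
      \int[lebesgue]_(t in I) (eps / 3 * G t) + \int[lebesgue]_(t in O) (eps / 3 * G t).
    rewrite lerDr; apply: Rintegral_ge0 => t _.
    by apply: mulr_ge0; [rewrite divr_ge0// ltW|exact: g0].
  rewrite -Rintegral_setU//; last by rewrite -AIO; exact: ciS.
  move=> /le_trans; apply; rewrite -AIO RintegralZl ?G1 ?mulr1//.
  exact: ciS.
case/andP: inner => in1 in2; case/andP: outer => ou1 ou2; case/andP: HJ => J1 J2.
have J0 : 0 <= J by apply: Rintegral_ge0 => t _; exact: P0.
have e1J : e1 * J <= eps / 3.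
  have e1pi : e1 * (2 * pi) = eps / 3.
    by rewrite /e1; move: pi0; move: (pi : R) => p p0; field; rewrite gt_eqF.
  by rewrite -e1pi; exact: ler_wpM2l (ltW e10) _ _ J2.
have GJ1 : G theta * J <= G theta * (2 * pi) by rewrite ler_wpM2l.
have GJ2 : G theta * (2 * pi) - eps / 3 <= G theta * J.
  apply: le_trans (ler_wpM2l g00 J1); rewrite mulrBr lerB//.
  rewrite /e2 mulrCA ler_wpM2l ?(ltW eps0)//.
  have G1' : 0 < G theta + 1 by rewrite ltr_wpDl.
  rewrite invfM mulrCA -[leRHS]mulr1 ler_wpM2l ?invr_ge0// ler_pdivrMr// mul1r lerDl.
  exact: ler01.
rewrite -/(G theta) [2 * pi * _]mulrC.
exact: (normr_sandwich in1 in2 ou1 ou2 e1J GJ1 GJ2).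
Qed.

End poisson_integral.

(** * Rate of convergence and the limit *)

Lemma scaled_density_bound (R : realType) (mu : probability (borel_circle R) R)
    (g : circle R -> R) (sigma x : R) :
  free_unitary_normal (sigma ^+ 2) mu -> continuous_density mu g ->
  0 < sigma -> sigma <= 4^-1 -> -2 < x < 2 ->
  `|sigma * (2 * pi * g (expi (sigma * x))) - Num.sqrt (4 - x ^+ 2)| <=
  (145 / Num.sqrt (4 - x ^+ 2) + 1) * sigma.
Proof.
move=> mu_s mu_g s0 s4 x2.
have th : - pi < sigma * x < pi.
  case/andP: x2 => h1 h2; have := pi_ge2 R.
  have a1 : sigma * x <= sigma * 2 by rewrite ler_wpM2l// ltW.
  have a2 : sigma * (- x) <= sigma * 2 by rewrite ler_wpM2l ?(ltW s0)//; lra.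
  by move=> p2; apply/andP; split; lra.
(* Tolerance 1 suffices: multiplied by [sigma], it contributes the summand 1 of the constant. *)
have [r0 /andP[r00 r01] Hr] := poisson_limit mu_g th ltr01.
pose M := Num.max r0 (1 - sigma ^+ 2).
have M1 : M < 1 by rewrite gt_max r01 ltrBlDr ltrDl exprn_gt0.
have M0 : r0 <= M by rewrite le_max lexx.
have Ms : 1 - sigma ^+ 2 <= M by rewrite le_max lexx orbT.
pose r := (M + 1) / 2.
have r0r : r0 < r < 1 by rewrite /r; apply/andP; split; lra.
have rI : 0 <= r < 1 by rewrite /r; apply/andP; split; lra.
have rs : 1 - sigma ^+ 2 <= r by rewrite /r; lra.
have /andP[_ r1] := rI.
pose Q := Qmoment mu (cis (- (sigma * x))) 0 r.
have Re_h := Re_herglotz_gt0 mu (normc_cis (- (sigma * x))) rI.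
have Eq := functional_equation mu_s (- (sigma * x)) rI.
(* With [h = 2 Q - 1] and [Q = 1 + psi], one has [h - 1 = 2 (Q - 1)] and [s h / 2 = s (Q - 1/2)]. *)
have h_eq : r%:C * cis (- (sigma * x)) * (2 * Q - 1 + 1) =
    (2 * Q - 1 - 1) * cexp ((sigma ^+ 2 / 2)%:C * (2 * Q - 1)).
  have -> : (sigma ^+ 2 / 2)%:C * (2 * Q - 1) = (sigma ^+ 2)%:C * (Q - 2^-1).
    by rewrite rmorphM /= fmorphV /= rmorph_nat; field.
  have -> : 2 * Q - 1 - 1 = 2 * (Q - 1) by ring.
  by rewrite subrK mulrCA Eq mulrA.
have B := semicircle_bound s0 s4 x2 rs (ltW r1) Re_h h_eq.
have P := Hr r r0r.
rewrite -/Q in P B.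
move: B P; move: (complex.Re _) (Num.sqrt _) (2 * pi * g _) => a q b B P.
have -> : sigma * b - q = (sigma * a - q) - sigma * (a - b) by ring.
rewrite (le_trans (ler_normB _ _))// mulrDl mul1r lerD//.
by rewrite normrM (gtr0_norm s0) ler_piMr// ltW.
Qed.

Local Close Scope complex_scope.
Unset Implicit Arguments.
Set Strict Implicit.
Set Printing Implicit Defensive.

Theorem proposition2p21 (R : realType)
    (N : R -> probability (borel_circle R) R) (f : R -> circle R -> R)
    (hN : forall s : R, 0 < s -> free_unitary_normal s (N s))
    (hf : forall s : R, 0 < s -> continuous_density (N s) (f s))
    (x : R) (hx : -2 < x < 2) :
  sigma * f (sigma ^+ 2) (expi (sigma * x)) @[sigma --> (0 : R)^'+]
    --> (2 * pi)^-1 * Num.sqrt (4 - x ^+ 2).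
Proof.
have pi2 := pi_ge2 R.
have K0 : 0 < 145 / Num.sqrt (4 - x ^+ 2) + 1.
  by rewrite ltr_wpDl// divr_ge0// sqrtr_ge0.
apply/cvgrPdist_le => /= eps eps0; near=> sigma.
have s0 : 0 < sigma by near: sigma; exact: nbhs_right_gt.
have s4 : sigma <= 4^-1 by near: sigma; apply: nbhs_right_le; rewrite invr_gt0.
have sK : sigma <= eps / (145 / Num.sqrt (4 - x ^+ 2) + 1).
  by near: sigma; apply: nbhs_right_le; rewrite divr_gt0.
have ss0 : 0 < sigma ^+ 2 by rewrite exprn_gt0.
have B := scaled_density_bound (hN _ ss0) (hf _ ss0) s0 s4 hx.
rewrite ler_pdivlMr// in sK.
move: B sK; set b := f _ _; set q := Num.sqrt _; set K := _ + 1 => B sK.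
have p0 : 0 < 2 * pi :> R by rewrite mulr_gt0// pi_gt0.
have -> : (2 * pi)^-1 * q - sigma * b = - ((2 * pi)^-1 * (sigma * (2 * pi * b) - q)).
  by move: (pi_gt0 R); move: (pi : R) => p p1; field; rewrite gt_eqF.
rewrite normrN normrM gtr0_norm ?invr_gt0// ler_pdivrMl//.
rewrite (le_trans B)// mulrC (le_trans sK)//.
by rewrite ler_peMl ?(ltW eps0)//; lra.
Unshelve. all: by end_near. Qed.
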